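(* Let $v,a,b,c\in\mathbb{C}$ with $\Re(v)<2$, $\Re(c)>0$, and $\Re(vc+a+b)>0$, $\Re(vc+a-b)>0$, $\Re(vc-a+b)>0$, $\Re(vc-a-b)>0$. Fix a square root $\sqrt{a^2+b^2}$ and put $\lambda_1=\frac v2-\frac{\sqrt{a^2+b^2}}{2c}$, $\lambda_2=\frac v2+\frac{\sqrt{a^2+b^2}}{2c}$, $\sigma_3=\frac v2-\frac{a}{2c}-\frac{b}{2c}$, $\sigma_4=\frac v2-\frac{a}{2c}+\frac{b}{2c}$, $\sigma_5=\frac v2+\frac{a}{2c}+\frac{b}{2c}$, $\sigma_6=\frac v2+\frac{a}{2c}-\frac{b}{2c}$, and $P=(vc-a-b)(vc+a+b)(vc-a+b)(vc+a-b)$. Assume $\frac v2,\lambda_1,\lambda_2\notin\mathbb{Z}_0^-$ and $1+\sigma_j\notin\mathbb{Z}_0^-$ for $j=3,4,5,6$. Then $$ {}_8F_7\!\left(\begin{matrix}v,\ 1+\frac v2,\ 1+\lambda_1,\ 1+\lambda_2,\ \sigma_3,\ \sigma_4,\ \sigma_5,\ \sigma_6\\ \frac v2,\ \lambda_1,\ \lambda_2,\ 1+\sigma_3,\ 1+\sigma_4,\ 1+\sigma_5,\ 1+\sigma_6\end{matrix};\,-1\right) =\frac{P}{8\,(v^3c^4-a^2vc^2-b^2vc^2)\,\Gamma(v)}\Big[\Gamma(\sigma_5)\Gamma(\sigma_3)+\Gamma(\sigma_6)\Gamma(\sigma_4)\Big]. $$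
   Context: $\mathbb{Z}_0^-=\{0,-1,-2,\dots\}$. The Pochhammer symbol is $(\lambda)_0=1$, $(\lambda)_n=\lambda(\lambda+1)\cdots(\lambda+n-1)$ for $n\ge1$. The generalized hypergeometric series is ${}_pF_q\!\left(\begin{matrix}\alpha_1,\dots,\alpha_p\\ \beta_1,\dots,\beta_q\end{matrix};z\right)=\sum_{n=0}^\infty\frac{(\alpha_1)_n\cdots(\alpha_p)_n}{(\beta_1)_n\cdots(\beta_q)_n}\frac{z^n}{n!}$ (with no $\beta_j\in\mathbb{Z}_0^-$); when $p=q+1$ and $z=-1$ it converges if $\Re(\sum\beta_j-\sum\alpha_i)>-1$. $\Gamma$ is Euler's gamma function. *)

(* Defs.v *)
From Stdlib Require Import Reals List ClassicalEpsilon Factorial.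
From Stdlib Require Export Reals.
Open Scope R_scope.

Definition CC : Type := (R * R)%type.
Definition RtoC (x : R) : CC := (x, 0).
Definition CC0 : CC := (0, 0).
Definition CC1 : CC := (1, 0).
Definition Cre (z : CC) : R := fst z.
Definition Cim (z : CC) : R := snd z.
Definition Cadd (z w : CC) : CC := (fst z + fst w, snd z + snd w).
Definition Copp (z : CC) : CC := (- fst z, - snd z).
Definition Csub (z w : CC) : CC := Cadd z (Copp w).
Definition Cmul (z w : CC) : CC :=
  (fst z * fst w - snd z * snd w, fst z * snd w + snd z * fst w).
Definition Cinv (z : CC) : CC :=
  (fst z / (fst z ^ 2 + snd z ^ 2), - snd z / (fst z ^ 2 + snd z ^ 2)).
Definition Cdiv (z w : CC) : CC := Cmul z (Cinv w).
Definition Cmod (z : CC) : R := sqrt (fst z ^ 2 + snd z ^ 2).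
Fixpoint Cpow (z : CC) (n : nat) : CC :=
  match n with O => CC1 | S m => Cmul z (Cpow z m) end.
Definition Cexp (z : CC) : CC := (exp (fst z) * cos (snd z), exp (fst z) * sin (snd z)).
Definition Cnatpow (n : nat) (z : CC) : CC := Cexp (Cmul z (RtoC (ln (INR n)))).

Fixpoint poch (z : CC) (n : nat) : CC :=
  match n with O => CC1 | S m => Cmul (poch z m) (Cadd z (RtoC (INR m))) end.

Definition Cseq_cv (u : nat -> CC) (l : CC) : Prop :=
  forall eps : R, eps > 0 -> exists N : nat, forall n : nat, (n >= N)%nat ->
    Cmod (Csub (u n) l) < eps.

Fixpoint Cpartial (u : nat -> CC) (n : nat) : CC :=
  match n with O => u O | S m => Cadd (Cpartial u m) (u (S m)) end.

Definition Cseries_sum (u : nat -> CC) (l : CC) : Prop := Cseq_cv (Cpartial u) l.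

(* reciprocal Gamma function 1/Gamma, via Gauss' limit formula
   1/Gamma(z) = lim_n z(z+1)...(z+n) / (n! n^z)   (entire; zero at the poles of Gamma) *)
Definition rgamma_lim (z g : CC) : Prop :=
  Cseq_cv (fun n => Cdiv (poch z (S n)) (Cmul (RtoC (INR (fact n))) (Cnatpow n z))) g.
Definition rGamma (z : CC) : CC := epsilon (inhabits CC0) (rgamma_lim z).
(* Euler's Gamma function (meaningful off the poles 0,-1,-2,...) *)
Definition CGamma (z : CC) : CC := Cinv (rGamma z).

Definition notin_Z0m (z : CC) : Prop := forall k : nat, z <> RtoC (- INR k).

Definition prodC (l : list CC) : CC := fold_right Cmul CC1 l.

Definition hyp_term (alphas betas : list CC) (z : CC) (n : nat) : CC :=
  Cdiv (Cmul (prodC (map (fun a => poch a n) alphas)) (Cpow z n))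
       (Cmul (prodC (map (fun b => poch b n) betas)) (RtoC (INR (fact n)))).

Definition hyper_sum (alphas betas : list CC) (z l : CC) : Prop :=
  Cseries_sum (hyp_term alphas betas z) l.

Definition CC2 : CC := RtoC 2.
Definition CC8 : CC := RtoC 8.

(* Main.v *)
(* With [m = n + v/2], the quotients of Pochhammer symbols collapse and the general term becomes, up
   to a constant, [(-1)^n (v)_n / n!] times
   [m (m^2 - A^2 - B^2) / ((m^2 - (A+B)^2) (m^2 - (A-B)^2))], a sum of simple poles at the
   [n = - sigma_j].  As [sigma_3 + sigma_5 = sigma_4 + sigma_6 = v], everything reduces to
     [sum_n (-1)^n (v)_n / n! (1/(n+s) + 1/(n+t)) = Gamma(s) Gamma(t) / Gamma(v)],  [s + t = v],
   for [Re v < 2], where [Re s] and [Re t] may be negative, so the beta integral is not available.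
   With the weights [w_k(n) = prod_(j<n) (k-j)/(1+v+k+j)] the sum over [n <= k] is exactly
   [X_k = (v)_(k+1) k! / ((s)_(k+1) (t)_(k+1))], which tends to the right-hand side by Gauss' limit.
   For a fixed truncation [n < M], the defect [E_k] between the weighted sum and [X_k] satisfies
   a first-order recurrence in [k] with [E_(M-1) = 0], whose inhomogeneous term is explicit
   (a WZ pair) and, since [(w_k - w_(k-1)) k (k+v) = w_k M (M+v)] at [n = M], telescopes in absolute
   value.  Letting [k], then [M], tend to infinity gives the sum. *)

From Coquelicot Require Import Coquelicot.
Require Import Defs.
From Stdlib Require Import Reals List.
From Stdlib Require Import Factorial Lra Lia ClassicalEpsilon.
Import ListNotations.
Open Scope R_scope.

(** [CC] and Coquelicot's complex type are both [R * R], and the operations of the statement agree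
    with the library ones by conversion, so its lemmas, [ring] and [field] apply to them. *)
Local Notation ℂ := Complex.C.
Local Notation norm := Complex.Cmod.
Local Notation "'%' r" := (Complex.RtoC r) (at level 8, r at level 8, format "'%' r").
Local Notation "'#' n" := (Complex.RtoC (INR n)) (at level 8, n at level 8, format "'#' n").
Local Notation is_lim u l := (Cseq_cv (u : nat -> ℂ)%C (l : ℂ)%C).

(** * Modulus and limits of complex sequences *)

Lemma Cpair_eq (x y : ℂ) : fst x = fst y -> snd x = snd y -> x = y.
Proof. destruct x, y; simpl; intros; subst; reflexivity. Qed.

Lemma snd_le_Cmod (z : ℂ) : Rabs (snd z) <= norm z.
Proof. eapply Rle_trans; [apply Rmax_r | apply Rmax_Cmod]. Qed.

Lemma fst_le_Cmod (z : ℂ) : Rabs (fst z) <= norm z.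
Proof. eapply Rle_trans; [apply Rmax_l | apply Rmax_Cmod]. Qed.

Lemma Cmod_le_sum (z : ℂ) : norm z <= Rabs (fst z) + Rabs (snd z).
Proof.
  replace z with (Cplus (% (fst z)) (Cmult (0, 1) (% (snd z)))) at 1
    by (apply Cpair_eq; simpl; ring).
  eapply Rle_trans; [apply Cmod_triangle|].
  rewrite Cmod_mult, !Cmod_R. change (0, 1) with Ci. rewrite Cmod_Ci. lra.
Qed.

Lemma Cmod_minus_sym (x y : ℂ) : norm (x - y) = norm (y - x).
Proof. rewrite <- Cmod_opp. f_equal. ring. Qed.

Lemma Cmod_triangle_rev (x y : ℂ) : norm x - norm y <= norm (x + y).
Proof.
  assert (H := Cmod_triangle (x + y) (- y)). rewrite Cmod_opp in H.
  replace (x + y + - y)%C with x in H by ring. lra.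
Qed.

(** Reduces complex limits to pairs of real ones, so that the algebra of limits comes from real
    analysis. *)
Lemma Cseq_cv_components (u : nat -> ℂ) (l : ℂ) :
  is_lim u l <-> is_lim_seq (fun n => fst (u n)) (fst l) /\ is_lim_seq (fun n => snd (u n)) (snd l).
Proof.
  split.
  - intros H; split; apply is_lim_seq_spec; intros [e He];
      destruct (H e He) as [N HN]; exists N; intros n Hn; simpl;
      specialize (HN n Hn); change (norm (u n - l) < e) in HN.
    + eapply Rle_lt_trans; [apply (fst_le_Cmod (u n - l)) | exact HN].
    + eapply Rle_lt_trans; [apply (snd_le_Cmod (u n - l)) | exact HN].
  - intros [H1 H2] e He.
    apply is_lim_seq_spec in H1. apply is_lim_seq_spec in H2.
    assert (He2 : 0 < e / 2) by lra.
    destruct (H1 (mkposreal _ He2)) as [N1 HN1]. destruct (H2 (mkposreal _ He2)) as [N2 HN2].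
    exists (max N1 N2). intros n Hn.
    specialize (HN1 n ltac:(lia)). specialize (HN2 n ltac:(lia)). simpl in HN1, HN2.
    change (norm (u n - l) < e).
    eapply Rle_lt_trans; [apply Cmod_le_sum|]. simpl. unfold Rminus in *. lra.
Qed.

Lemma Cseq_cv_const (l : ℂ) : is_lim (fun _ => l) l.
Proof. apply Cseq_cv_components; split; apply is_lim_seq_const. Qed.

Lemma Cseq_cv_plus (u w : nat -> ℂ) (l m : ℂ) :
  is_lim u l -> is_lim w m -> is_lim (fun n => u n + w n)%C (l + m).
Proof.
  rewrite !Cseq_cv_components. intros [? ?] [? ?]. split; simpl; now apply is_lim_seq_plus'.
Qed.

Lemma Cseq_cv_mult (u w : nat -> ℂ) (l m : ℂ) :
  is_lim u l -> is_lim w m -> is_lim (fun n => u n * w n)%C (l * m).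
Proof.
  rewrite !Cseq_cv_components. intros [? ?] [? ?]. split; simpl.
  - apply is_lim_seq_minus'; now apply is_lim_seq_mult'.
  - apply is_lim_seq_plus'; now apply is_lim_seq_mult'.
Qed.

Lemma Cseq_cv_minus (u w : nat -> ℂ) (l m : ℂ) :
  is_lim u l -> is_lim w m -> is_lim (fun n => u n - w n)%C (l - m).
Proof.
  rewrite !Cseq_cv_components. intros [? ?] [? ?]. split; simpl; now apply is_lim_seq_minus'.
Qed.

Lemma Cseq_cv_inv (u : nat -> ℂ) (l : ℂ) :
  l <> 0%C -> is_lim u l -> is_lim (fun n => / u n)%C (/ l).
Proof.
  intros Hl. rewrite !Cseq_cv_components. intros [H1 H2].
  assert (Hd : fst l ^ 2 + snd l ^ 2 <> 0).
  { intros E. apply Hl. apply Cpair_eq; simpl; nra. }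
  assert (H : is_lim_seq (fun n => fst (u n) ^ 2 + snd (u n) ^ 2) (fst l ^ 2 + snd l ^ 2)).
  { apply is_lim_seq_plus'.
    - apply is_lim_seq_ext with (fun n => fst (u n) * (fst (u n))); [intros; ring|].
      replace (fst l ^ 2) with (fst l * fst l) by ring. now apply is_lim_seq_mult'.
    - apply is_lim_seq_ext with (fun n => snd (u n) * (snd (u n))); [intros; ring|].
      replace (snd l ^ 2) with (snd l * snd l) by ring. now apply is_lim_seq_mult'. }
  split; simpl; apply is_lim_seq_div'; auto.
  apply (is_lim_seq_opp (fun n => snd (u n)) (snd l)); auto.
Qed.

Lemma Cseq_cv_ext (u w : nat -> ℂ) (l : ℂ) (N : nat) :
  (forall n, (N <= n)%nat -> u n = w n) -> is_lim u l -> is_lim w l.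
Proof.
  intros E H e He. destruct (H e He) as [N' HN]. exists (max N N'). intros n Hn.
  rewrite <- E by lia. apply HN. lia.
Qed.

Lemma Cseq_cv_shift (u : nat -> ℂ) (l : ℂ) (N : nat) :
  is_lim (fun n => u (n + N)%nat) l <-> is_lim u l.
Proof.
  split; intros H e He; destruct (H e He) as [M HM].
  - exists (M + N)%nat. intros n Hn. replace n with ((n - N) + N)%nat by lia. apply HM. lia.
  - exists M. intros n Hn. apply HM. lia.
Qed.

Lemma Cseq_cv_unique (u : nat -> ℂ) (l m : ℂ) : is_lim u l -> is_lim u m -> l = m.
Proof.
  rewrite !Cseq_cv_components. intros [H1 H2] [H3 H4].
  apply Cpair_eq.
  - apply is_lim_seq_unique in H1. apply is_lim_seq_unique in H3. congruence.
  - apply is_lim_seq_unique in H2. apply is_lim_seq_unique in H4. congruence.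
Qed.

Lemma Cseq_cv_dist (u : nat -> ℂ) (l : ℂ) (b : nat -> R) (N : nat) :
  (forall n, (N <= n)%nat -> norm (u n - l) <= b n) -> is_lim_seq b 0 -> is_lim u l.
Proof.
  intros H Hb e He. apply is_lim_seq_spec in Hb.
  destruct (Hb (mkposreal e He)) as [M HM]. simpl in HM.
  exists (max N M). intros n Hn. change (norm (u n - l) < e).
  specialize (H n ltac:(lia)). specialize (HM n ltac:(lia)).
  apply Rabs_def2 in HM. lra.
Qed.

Lemma Cseq_cv_Cmod (u : nat -> ℂ) (l : ℂ) :
  is_lim u l -> is_lim_seq (fun n => norm (u n)) (norm l).
Proof.
  intros H. apply is_lim_seq_spec. intros [e He]. destruct (H e He) as [N HN].
  exists N. intros n Hn. specialize (HN n Hn). change (norm (u n - l) < e) in HN.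
  simpl. apply Rabs_def1.
  - assert (T := Cmod_triangle (u n - l) l). replace (u n - l + l)%C with (u n) in T by ring. lra.
  - assert (T := Cmod_triangle_rev l (u n - l)). replace (l + (u n - l))%C with (u n) in T by ring.
    lra.
Qed.

Lemma Cseq_cv_Cmod_le (u : nat -> ℂ) (l : ℂ) (b : nat -> R) (m : R) (N : nat) :
  (forall n, (N <= n)%nat -> norm (u n) <= b n) -> is_lim u l -> is_lim_seq b m -> norm l <= m.
Proof.
  intros H Hu Hb.
  apply (is_lim_seq_le_loc (fun n => norm (u n)) b (norm l) m); auto.
  - exists N. exact H.
  - now apply Cseq_cv_Cmod.
Qed.

(** * Real sequences with summable increments *)

Lemma INR_S_pos n : 0 < INR n + 1.
Proof. assert (H := pos_INR n). lra. Qed.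

Lemma inv_INR_S_lim : is_lim_seq (fun n => / (INR n + 1)) 0.
Proof.
  apply (is_lim_seq_ext (fun n => / INR (S n))); [intros; now rewrite S_INR|].
  apply -> (is_lim_seq_incr_1 (fun n => / INR n)).
  apply (is_lim_seq_inv _ p_infty); [apply is_lim_seq_INR | discriminate].
Qed.

(** Comparison of 1/N^2 with 2/(N(N+1)), N = n + 1. This telescoping majorant replaces the sum of
    the series 1/n^2 in what follows. *)
Lemma inv_sqr_telescope n : / (INR n + 1) ^ 2 <= 2 * (/ (INR n + 1) - / (INR (S n) + 1)).
Proof.
  assert (H := pos_INR n). rewrite S_INR.
  replace (2 * (/ (INR n + 1) - / (INR n + 1 + 1))) with (2 / ((INR n + 1) * (INR n + 2)))
    by (field; lra).
  apply Rmult_le_reg_r with ((INR n + 1) ^ 2 * (INR n + 2)).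
  - apply Rmult_lt_0_compat; [apply pow_lt|]; lra.
  - field_simplify; try lra.
Qed.

(** With [b n] = 2K/(n+1) each step is at most [b n - b (S n)], so [a - b] increases, [a + b]
    decreases, and bounded monotonicity gives the limit. *)
Lemma real_cv_of_summable_steps (a : nat -> R) (K : R) :
  (forall n, Rabs (a (S n) - a n) <= K / (INR n + 1) ^ 2) -> ex_finite_lim_seq a.
Proof.
  intros H.
  assert (HK : 0 <= K).
  { specialize (H O). simpl in H. assert (0 <= Rabs (a 1%nat - a 0%nat)) by apply Rabs_pos.
    replace (K / ((0 + 1) * ((0 + 1) * 1))) with K in H by field. lra. }
  set (b := fun n => 2 * K * / (INR n + 1)).
  assert (Hs : forall n, Rabs (a (S n) - a n) <= b n - b (S n)).
  { intros n. eapply Rle_trans; [apply H|]. unfold b, Rdiv.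
    assert (T := inv_sqr_telescope n). nra. }
  assert (Hu : forall n, a (S n) - b (S n) >= a n - b n /\ a (S n) + b (S n) <= a n + b n).
  { intros n. specialize (Hs n). apply Rabs_le_between in Hs. lra. }
  assert (Hb : forall n, 0 <= b n).
  { intros n. apply Rmult_le_pos; [lra|]. left. apply Rinv_0_lt_compat, INR_S_pos. }
  destruct (ex_finite_lim_seq_incr (fun n => a n - b n) (a O + b O)) as [l Hl].
  - intros n. destruct (Hu n). lra.
  - assert (D : forall n, a n + b n <= a O + b O).
    { induction n; [lra|]. destruct (Hu n). lra. }
    intros n. specialize (D n). specialize (Hb n). lra.
  - exists l. apply (is_lim_seq_ext (fun n => (a n - b n) + b n)); [intros; ring|].
    replace l with (l + 2 * K * 0) by ring.
    apply is_lim_seq_plus'; auto.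
    apply (is_lim_seq_scal_l _ _ 0), inv_INR_S_lim.
Qed.

(** * Infinite products *)

(** Discrete Gronwall bound: 1 + x <= exp x turns the product into the exponential of a sum of
    K/(n+1)^2, which telescopes to at most 2K. *)
Lemma growth_le_exp (P : nat -> R) (K : R) :
  0 <= K -> (forall n, 0 <= P n) -> (forall n, P (S n) <= P n * (1 + K / (INR n + 1) ^ 2)) ->
  forall n, P n <= P O * exp (2 * K).
Proof.
  intros HK HP H.
  (* Strengthened claim for the induction: the exponent keeps the telescoped partial sum. *)
  assert (A : forall n, P n <= P O * exp (2 * K * (1 - / (INR n + 1)))).
  { induction n.
    - simpl. replace (2 * K * (1 - / (0 + 1))) with 0 by field. rewrite exp_0. lra.
    - eapply Rle_trans; [apply H|].
      eapply Rle_trans.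
      + apply Rmult_le_compat; [apply HP| |apply IHn|apply exp_ineq1_le].
        assert (0 <= K / (INR n + 1) ^ 2); [|lra].
        apply Rmult_le_pos; auto. left. apply Rinv_0_lt_compat, pow_lt, INR_S_pos.
      + rewrite Rmult_assoc, <- exp_plus. apply Rmult_le_compat_l; auto.
        assert (T := inv_sqr_telescope n).
        assert (U : K / (INR n + 1) ^ 2 <= K * (2 * (/ (INR n + 1) - / (INR (S n) + 1)))).
        { unfold Rdiv. now apply Rmult_le_compat_l. }
        assert (V : 2 * K * (1 - / (INR n + 1)) + K / (INR n + 1) ^ 2
                     <= 2 * K * (1 - / (INR (S n) + 1))) by lra.
        destruct V as [V|V]; [left; now apply exp_increasing | right; now rewrite V]. }
  intros n. eapply Rle_trans; [apply A|]. apply Rmult_le_compat_l; auto.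
  assert (V : 2 * K * (1 - / (INR n + 1)) <= 2 * K).
  { assert (0 < / (INR n + 1)) by apply Rinv_0_lt_compat, INR_S_pos. nra. }
  destruct V as [V|V]; [left; now apply exp_increasing | right; now rewrite V].
Qed.

(** The partial products are bounded by [growth_le_exp], so the increments [P n * (r n - 1)] are
    O(1/n^2). *)
Lemma product_cv (P r : nat -> ℂ) (K : R) :
  0 <= K -> (forall n, P (S n) = (P n * r n)%C) ->
  (forall n, norm (r n - 1) <= K / (INR n + 1) ^ 2) -> exists l : ℂ, is_lim P l.
Proof.
  intros HK HP Hr.
  assert (B : forall n, norm (P n) <= norm (P O) * exp (2 * K)).
  { apply growth_le_exp; auto; intros n; [apply Cmod_ge_0|].
    rewrite HP, Cmod_mult. apply Rmult_le_compat_l; [apply Cmod_ge_0|].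
    assert (T := Cmod_triangle 1 (r n - 1)). rewrite Cmod_1 in T.
    replace (1 + (r n - 1))%C with (r n) in T by ring. specialize (Hr n). lra. }
  set (K' := norm (P O) * exp (2 * K) * K).
  assert (D : forall n, norm (P (S n) - P n) <= K' / (INR n + 1) ^ 2).
  { intros n. rewrite HP. replace (P n * r n - P n)%C with (P n * (r n - 1))%C by ring.
    rewrite Cmod_mult. unfold K', Rdiv. rewrite Rmult_assoc.
    apply Rmult_le_compat; auto using Cmod_ge_0. }
  destruct (real_cv_of_summable_steps (fun n => fst (P n)) K') as [l1 H1].
  { intros n. eapply Rle_trans; [apply (fst_le_Cmod (P (S n) - P n)) | apply D]. }
  destruct (real_cv_of_summable_steps (fun n => snd (P n)) K') as [l2 H2].
  { intros n. eapply Rle_trans; [apply (snd_le_Cmod (P (S n) - P n)) | apply D]. }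
  exists (l1, l2). apply Cseq_cv_components. split; assumption.
Qed.

(** The reciprocals form a product of the same kind, with factors [/ r n] and constant 2K because |r
    n| >= 1/2; the two limits multiply to 1. *)
Lemma product_cv_nonzero (P r : nat -> ℂ) (K : R) :
  0 <= K -> (forall n, P (S n) = (P n * r n)%C) ->
  (forall n, norm (r n - 1) <= K / (INR n + 1) ^ 2) ->
  (forall n, norm (r n - 1) <= 1 / 2) -> P O <> 0%C ->
  exists l : ℂ, is_lim P l /\ l <> 0%C.
Proof.
  intros HK HP Hr Hh H0.
  assert (R2 : forall n, 1 / 2 <= norm (r n)).
  { intros n. assert (T := Cmod_triangle_rev 1 (r n - 1)). rewrite Cmod_1 in T.
    replace (1 + (r n - 1))%C with (r n) in T by ring. specialize (Hh n). lra. }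
  assert (R0 : forall n, r n <> 0%C).
  { intros n E. specialize (R2 n). rewrite E, Cmod_0 in R2. lra. }
  assert (N0 : forall n, P n <> 0%C).
  { induction n; auto. rewrite HP. now apply Cmult_neq_0. }
  destruct (product_cv P r K) as [l Hl]; auto.
  destruct (product_cv (fun n => / P n)%C (fun n => / r n)%C (2 * K)) as [m Hm]; [lra| | |].
  - intros n. rewrite HP. field. auto.
  - intros n. replace (/ r n - 1)%C with ((1 - r n) / r n)%C by (field; auto).
    rewrite Cmod_div, Cmod_minus_sym by auto.
    specialize (Hr n). specialize (R2 n). specialize (Cmod_ge_0 (r n - 1)) as Hp.
    unfold Rdiv. replace (2 * K * / (INR n + 1) ^ 2) with (K / (INR n + 1) ^ 2 * 2) by (unfold Rdiv; ring).
    apply Rmult_le_compat; auto.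
    + left. apply Rinv_0_lt_compat. lra.
    + replace 2 with (/ (1 / 2)) by field. apply Rinv_le_contravar; lra.
  - exists l. split; auto. intros E.
    assert (H1 : is_lim (fun n => P n * / P n) (l * m)) by now apply Cseq_cv_mult.
    assert (H2 : is_lim (fun n => P n * / P n) 1).
    { apply (Cseq_cv_ext (fun _ => % 1) _ _ 0); [|apply Cseq_cv_const].
      intros n _. field. auto. }
    assert (E1 := Cseq_cv_unique _ _ _ H1 H2). rewrite E in E1.
    assert (E2 : fst (0 * m)%C = fst (Complex.RtoC 1)) by now rewrite E1.
    simpl in E2. lra.
Qed.

(** * Gauss' limit *)

(** Everything follows from |sin t| <= |t|: the half-angle formula gives the bound for the cosine,
    and the mean value theorem for sin t - t carries it to the sine. *)
Lemma cos_sin_bounds y : Rabs (cos y - 1) <= y ^ 2 / 2 /\ Rabs (sin y - y) <= Rabs y ^ 3.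
Proof.
  assert (S : forall t, Rabs (sin t) <= Rabs t).
  { intros t. destruct (MVT_gen sin 0 t cos) as [c [_ Hc]].
    - intros x _. apply is_derive_Reals, derivable_pt_lim_sin.
    - intros x _. apply continuity_sin.
    - rewrite sin_0 in Hc. replace (sin t) with (cos c * t) by lra.
      rewrite Rabs_mult. assert (Rabs (cos c) <= 1) by (apply Rabs_le; apply COS_bound).
      assert (H0 := Rabs_pos t). nra. }
  assert (Co : forall t, Rabs (cos t - 1) <= t ^ 2 / 2).
  { intros t. replace (cos t) with (1 - 2 * sin (t / 2) * sin (t / 2))
      by (rewrite <- cos_2a_sin; f_equal; field).
    replace (1 - 2 * sin (t / 2) * sin (t / 2) - 1) with (- (2 * (sin (t / 2)) ^ 2)) by ring.
    rewrite Rabs_Ropp, Rabs_pos_eq by nra.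
    assert (H := S (t / 2)). apply Rsqr_le_abs_1 in H. unfold Rsqr in H. lra. }
  split; auto.
  destruct (MVT_gen (fun t => sin t - t) 0 y (fun t => cos t - 1)) as [c [Hc1 Hc]].
  - intros x _. auto_derive; auto; ring.
  - intros x _. apply derivable_continuous_pt. reg.
  - rewrite sin_0 in Hc. replace (sin y - y) with ((cos c - 1) * y) by lra.
    rewrite Rabs_mult. simpl (_ ^ 3).
    assert (c ^ 2 <= Rabs y ^ 2).
    { rewrite <- (pow2_abs c). apply pow_incr. split; [apply Rabs_pos|].
      destruct (Rle_dec 0 y) as [H|H].
      - rewrite Rmin_left, Rmax_right in Hc1 by lra. apply Rabs_le. rewrite Rabs_pos_eq; lra.
      - rewrite Rmin_right, Rmax_left in Hc1 by lra. apply Rabs_le. rewrite Rabs_left1; lra. }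
    specialize (Co c). assert (Hy := Rabs_pos y).
    assert (Rabs (cos c - 1) <= Rabs y ^ 2) by nra.
    assert (Rabs (cos c - 1) * Rabs y <= Rabs y ^ 2 * Rabs y) by (apply Rmult_le_compat_r; auto).
    simpl in *. lra.
Qed.

(** The upper bound comes from exp (-x) >= 1 - x, which gives exp x <= 1/(1 - x). *)
Lemma exp_quadratic_bound x : Rabs x <= 1 / 2 -> 0 <= exp x - 1 - x <= 2 * x ^ 2.
Proof.
  intros H. apply Rabs_le_between in H.
  assert (L := exp_ineq1_le x). split; [lra|].
  assert (L' := exp_ineq1_le (- x)).
  assert (E : exp x * exp (- x) = 1) by (rewrite <- exp_plus, Rplus_opp_r; apply exp_0).
  assert (P := exp_pos x). nra.
Qed.

Lemma Cmod_sqr (z : ℂ) : norm z ^ 2 = fst z ^ 2 + snd z ^ 2.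
Proof. apply Cmod2_alt. Qed.

Lemma Cexp_quadratic_bound (w : ℂ) :
  norm w <= 1 / 2 -> norm (Cexp w - 1 - w) <= 4 * norm w ^ 2.
Proof.
  intros Hw. rewrite Cmod_sqr. eapply Rle_trans; [apply Cmod_le_sum|].
  assert (Hx := fst_le_Cmod w). assert (Hy := snd_le_Cmod w).
  destruct w as [x y]. simpl fst in *. simpl snd in *.
  destruct (cos_sin_bounds y) as [C1 C2].
  destruct (exp_quadratic_bound x) as [E1 E2]; [lra|].
  assert (Hx1 : Rabs x <= 1 / 2) by lra. assert (Hy1 : Rabs y <= 1 / 2) by lra.
  assert (X2 := pow2_abs x). assert (Y2 := pow2_abs y).
  assert (Px := Rabs_pos x). assert (Py := Rabs_pos y).
  assert (EX : Rabs (exp x - 1) <= 2 * Rabs x).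
  { replace (exp x - 1) with ((exp x - 1 - x) + x) by ring.
    eapply Rle_trans; [apply Rabs_triang|]. rewrite (Rabs_pos_eq (exp x - 1 - x)) by lra. nra. }
  assert (E3 : 0 < exp x <= 2).
  { split; [apply exp_pos|]. apply Rabs_le_between in Hx1. nra. }
  replace (exp x * cos y + - (1) + - x) with ((exp x - 1 - x) + exp x * (cos y - 1)) by ring.
  replace (exp x * sin y + - 0 + - y) with ((exp x - 1) * sin y + (sin y - y)) by ring.
  assert (A1 : Rabs (exp x - 1 - x + exp x * (cos y - 1)) <= 2 * x ^ 2 + y ^ 2).
  { eapply Rle_trans; [apply Rabs_triang|].
    rewrite (Rabs_pos_eq (exp x - 1 - x)) by lra. rewrite Rabs_mult, (Rabs_pos_eq (exp x)) by lra.
    assert (T := Rabs_pos (cos y - 1)). nra. }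
  assert (S1 : Rabs (sin y) <= 2 * Rabs y).
  { replace (sin y) with (y + (sin y - y)) by ring.
    eapply Rle_trans; [apply Rabs_triang|]. assert (Rabs y ^ 3 <= Rabs y); [|lra].
    simpl. assert (Rabs y * Rabs y <= 1) by nra. nra. }
  assert (A2 : Rabs ((exp x - 1) * sin y + (sin y - y)) <= 2 * x ^ 2 + 3 * y ^ 2).
  { eapply Rle_trans; [apply Rabs_triang|]. rewrite Rabs_mult.
    assert (Rabs (exp x - 1) * Rabs (sin y) <= (2 * Rabs x) * (2 * Rabs y))
      by (apply Rmult_le_compat; auto using Rabs_pos).
    assert (Rabs y ^ 3 <= Rabs y ^ 2) by (simpl; nra).
    assert (0 <= (Rabs x - Rabs y) ^ 2) by apply pow2_ge_0.
    nra. }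
  lra.
Qed.

Lemma Cexp_plus (z w : ℂ) : Cexp (z + w)%C = Cmult (Cexp z) (Cexp w).
Proof.
  apply Cpair_eq; simpl; rewrite exp_plus, ?cos_plus, ?sin_plus; ring.
Qed.

Lemma Cmod_Cexp (z : ℂ) : norm (Cexp z) = exp (fst z).
Proof.
  rewrite <- (Rabs_pos_eq (exp (fst z))) by (left; apply exp_pos).
  apply Rsqr_inj; [apply Cmod_ge_0 | apply Rabs_pos |].
  rewrite Rabs_pos_eq by (left; apply exp_pos). unfold Rsqr.
  replace (norm (Cexp z) * norm (Cexp z)) with (norm (Cexp z) ^ 2) by ring.
  rewrite Cmod_sqr. simpl. assert (T := sin2_cos2 (snd z)). unfold Rsqr in T.
  replace (exp (fst z) * exp (fst z)) with
    (exp (fst z) * exp (fst z) * (sin (snd z) * sin (snd z) + cos (snd z) * cos (snd z)))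
    by (rewrite T; ring). ring.
Qed.

Lemma Cexp_neq_0 (z : ℂ) : (Cexp z : ℂ) <> 0%C.
Proof. apply Cmod_gt_0. rewrite Cmod_Cexp. apply exp_pos. Qed.

(** The sequence of [rgamma_lim], whose limit is 1/Gamma(z). *)
Definition gauss_seq (z : ℂ) (n : nat) : ℂ :=
  (poch z (S n) / (# (fact n) * Cnatpow n z))%C.

Lemma poch_S (z : ℂ) n : poch z (S n) = (poch z n * (z + # n))%C.
Proof. reflexivity. Qed.

Lemma INR_C_S n : # (S n) = (# n + 1)%C.
Proof. rewrite S_INR. apply Cpair_eq; simpl; ring. Qed.

Lemma INR_C_neq_0 n : (0 < n)%nat -> # n <> 0%C.
Proof. intros H E. apply (f_equal fst) in E. simpl in E. apply lt_0_INR in H. lra. Qed.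

Lemma fact_C_neq_0 n : # (fact n) <> 0%C.
Proof. apply INR_C_neq_0, lt_O_fact. Qed.

Lemma fact_C_S n : # (fact (S n)) = ((# n + 1) * # (fact n))%C.
Proof.
  rewrite <- INR_C_S. change (fact (S n)) with (S n * fact n)%nat.
  rewrite mult_INR. apply Cpair_eq; simpl; ring.
Qed.

(** Indices start at one, since the power of n at n = 0 would involve the default value of
    [ln 0]. *)
Lemma gauss_seq_S (z : ℂ) n :
  gauss_seq z (S (S n)) = (gauss_seq z (S n) *
   ((1 + z / # (S (S n))) * Cexp (z * % (ln (INR (S n)) - ln (INR (S (S n)))))))%C.
Proof.
  unfold gauss_seq. rewrite (poch_S z (S (S n))), (fact_C_S (S n)).
  assert (E : @eq ℂ (Cnatpow (S n) z)
    (Cnatpow (S (S n)) z * Cexp (z * % (ln (INR (S n)) - ln (INR (S (S n))))))%C).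
  { unfold Cnatpow. change Cmul with Cmult. change RtoC with Complex.RtoC. rewrite <- Cexp_plus. f_equal.
    apply Cpair_eq; simpl; ring. }
  assert (N1 := Cexp_neq_0 (z * % (ln (INR (S (S n)))))). change (Cexp _) with (Cnatpow (S (S n)) z) in N1.
  assert (N2 := Cexp_neq_0 (z * % (ln (INR (S n)) - ln (INR (S (S n)))))).
  rewrite E, <- INR_C_S. field. repeat split; auto using fact_C_neq_0.
  apply INR_C_neq_0. lia.
Qed.

(** Applying 1 + x <= exp x at 1/N and at -1/(N+1), with N = n + 1, gives 1/(N+1) <= ln (N+1) - ln N
    <= 1/N. *)
Lemma ln_step_bound n :
  let l := ln (INR (S n)) - ln (INR (S (S n))) in
  Rabs l <= / (INR n + 1) /\ Rabs (/ INR (S (S n)) + l) <= / (INR n + 1) ^ 2.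
Proof.
  intros l. set (N := INR n + 1). assert (HN : 1 <= N) by (unfold N; assert (H := pos_INR n); lra).
  assert (E2 : INR (S (S n)) = N + 1) by (unfold N; rewrite !S_INR; ring).
  assert (E1 : INR (S n) = N) by (unfold N; rewrite !S_INR; ring).
  unfold l. rewrite E1, E2.
  assert (A : ln (N + 1) - ln N <= / N).
  { rewrite <- ln_div by lra. replace ((N + 1) / N) with (1 + / N) by (field; lra).
    assert (H := exp_ineq1_le (/ N)). rewrite <- (ln_exp (/ N)) at 2.
    assert (0 < / N) by (apply Rinv_0_lt_compat; lra).
    apply ln_le; lra. }
  assert (B : ln N - ln (N + 1) <= - / (N + 1)).
  { rewrite <- ln_div by lra. replace (N / (N + 1)) with (1 + - / (N + 1)) by (field; lra).
    assert (H := exp_ineq1_le (- / (N + 1))). rewrite <- (ln_exp (- / (N + 1))) at 2.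
    assert (/ (N + 1) < 1) by (rewrite <- Rinv_1; apply Rinv_lt_contravar; lra).
    apply ln_le; lra. }
  assert (C1 : 0 < / (N + 1)) by (apply Rinv_0_lt_compat; lra).
  split; [apply Rabs_le; lra|].
  assert (D : / N - / (N + 1) <= / N ^ 2).
  { replace (/ N - / (N + 1)) with (/ (N * (N + 1))) by (field; lra).
    apply Rinv_le_contravar; nra. }
  assert (0 < / N ^ 2) by (apply Rinv_0_lt_compat; nra).
  apply Rabs_le; lra.
Qed.

(** The first-order parts z/(n+2) and z (ln (n+1) - ln (n+2)) cancel up to O(1/n^2); the hypothesis
    keeps the argument of the exponential in the disc of radius 1/2. *)
Lemma gauss_ratio_bound (z : ℂ) n :
  2 * norm z <= INR n + 1 ->
  norm ((1 + z / # (S (S n))) * Cexp (z * % (ln (INR (S n)) - ln (INR (S (S n)))))%C - 1)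
    <= (norm z + 9 * norm z ^ 2) / (INR n + 1) ^ 2.
Proof.
  intros H. destruct (ln_step_bound n) as [L1 L2]. cbv zeta in L1, L2.
  set (l := ln (INR (S n)) - ln (INR (S (S n)))) in *.
  set (w := (z * % l)%C). set (N := # (S (S n))).
  set (q := / (INR n + 1)) in *.
  assert (Hq : 0 < q) by apply Rinv_0_lt_compat, INR_S_pos.
  assert (Hz := Cmod_ge_0 z).
  assert (HN : N <> 0%C) by (apply INR_C_neq_0; lia).
  assert (Mw : norm w <= norm z * q).
  { unfold w. rewrite Cmod_mult, Cmod_R. apply Rmult_le_compat_l; auto. }
  assert (zq : norm z * q <= 1 / 2).
  { apply Rmult_le_reg_r with (INR n + 1); [apply INR_S_pos|].
    unfold q. rewrite Rmult_assoc, Rinv_l; [lra | apply Rgt_not_eq, INR_S_pos]. }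
  assert (MN : norm (z / N) <= norm z * q).
  { rewrite Cmod_div by auto. apply Rmult_le_compat_l; auto.
    unfold N. rewrite Cmod_R, Rabs_pos_eq by apply pos_INR.
    apply Rinv_le_contravar; [apply INR_S_pos|]. rewrite !S_INR. lra. }
  assert (R := Cexp_quadratic_bound w ltac:(lra)).
  set (rho := (Cexp w - 1 - w)%C) in *.
  assert (Ex : (1 + w + rho)%C = Cexp w) by (unfold rho; ring). rewrite <- Ex.
  (* The cancelled first-order part, the product of the two first-order terms, and the quadratic
     remainder [rho] of the exponential: they contribute |z| q^2, |z|^2 q^2 and 8 |z|^2 q^2. *)
  replace ((1 + z / N) * (1 + w + rho) - 1)%C
    with (z * (/ N + % l) + (z / N) * w + (1 + z / N) * rho)%C by (unfold w; field; auto).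
  eapply Rle_trans; [apply Cmod_triangle|].
  eapply Rle_trans; [apply Rplus_le_compat_r, Cmod_triangle|].
  rewrite (Cmod_mult (z / N) w), (Cmod_mult (1 + z / N) rho), Cmod_mult.
  assert (T1 : norm (/ N + % l) <= q ^ 2).
  { unfold N. rewrite <- RtoC_inv by (apply not_0_INR; lia). rewrite <- RtoC_plus, Cmod_R. unfold q. rewrite pow_inv. exact L2. }
  assert (T2 : norm (z / N) * norm w <= (norm z * q) * (norm z * q))
    by (apply Rmult_le_compat; auto using Cmod_ge_0).
  assert (T3 : norm (1 + z / N) <= 2).
  { eapply Rle_trans; [apply Cmod_triangle|]. rewrite Cmod_1. lra. }
  assert (T4 : norm rho <= 4 * (norm z * q) ^ 2).
  { eapply Rle_trans; [exact R|]. apply Rmult_le_compat_l; [lra|].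
    apply pow_incr. split; auto using Cmod_ge_0. }
  assert (T5 : norm (1 + z / N) * norm rho <= 2 * (4 * (norm z * q) ^ 2))
    by (apply Rmult_le_compat; auto using Cmod_ge_0).
  assert (T6 : norm z * norm (/ N + % l) <= norm z * q ^ 2) by (apply Rmult_le_compat_l; auto).
  unfold Rdiv. rewrite <- pow_inv. fold q. nra.
Qed.

Lemma poch_neq_0 (z : ℂ) n : (forall k, z <> (% (- INR k))) -> poch z n <> (0 : ℂ)%C.
Proof.
  intros H. induction n as [|n IH].
  - intros E. apply (f_equal fst) in E. simpl in E. lra.
  - rewrite poch_S. apply Cmult_neq_0; auto. intros E. apply (H n).
    replace (% (- INR n)) with (- # n)%C by (apply Cpair_eq; simpl; ring).
    replace z with (z + # n - # n)%C by ring. rewrite E. ring.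
Qed.

Lemma gauss_seq_cv (z : ℂ) :
  exists l : ℂ, is_lim (gauss_seq z) l /\ ((forall k, z <> (% (- INR k))) -> l <> 0%C).
Proof.
  set (K := norm z + 9 * norm z ^ 2).
  assert (Hz := Cmod_ge_0 z).
  assert (HK : 0 <= K) by (unfold K; nra).
  (* Beyond this N, 2|z| <= n + N + 1 gives the ratio bound, and K/(2K+1)^2 <= 1/2 keeps every
     factor away from zero. *)
  destruct (INR_unbounded (2 * norm z + 2 * K)) as [N HN].
  set (P := fun n => gauss_seq z (S (n + N))).
  set (r := fun n => ((1 + z / # (S (S (n + N)))) *
    Cexp (z * % (ln (INR (S (n + N))) - ln (INR (S (S (n + N)))))))%C).
  assert (HP : forall n, P (S n) = (P n * r n)%C) by (intros n; apply gauss_seq_S).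
  assert (HNn : forall n, INR n + INR N = INR (n + N)) by (intros; now rewrite plus_INR).
  assert (Hr : forall n, norm (r n - 1) <= K / (INR (n + N) + 1) ^ 2).
  { intros n. apply gauss_ratio_bound. rewrite <- HNn. assert (H := pos_INR n). lra. }
  assert (Hr1 : forall n, norm (r n - 1) <= K / (INR n + 1) ^ 2).
  { intros n. eapply Rle_trans; [apply Hr|]. apply Rmult_le_compat_l; auto.
    assert (H := pos_INR n). assert (H' := pos_INR N).
    apply Rinv_le_contravar; [apply pow_lt; lra|]. apply pow_incr. rewrite <- HNn. lra. }
  assert (Hr2 : forall n, norm (r n - 1) <= 1 / 2).
  { intros n. eapply Rle_trans; [apply Hr|].
    assert (H := pos_INR n).
    assert (H2 : 2 * K + 1 <= INR (n + N) + 1) by (rewrite <- HNn; lra).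
    apply Rmult_le_reg_r with ((INR (n + N) + 1) ^ 2); [apply pow_lt; lra|].
    unfold Rdiv at 1. rewrite Rmult_assoc, Rinv_l by (apply pow_nonzero; lra). nra. }
  assert (S1 : forall l, is_lim P l -> is_lim (gauss_seq z) l).
  { intros l Hl. apply (Cseq_cv_shift _ _ (S N)).
    apply (Cseq_cv_ext P _ _ 0); auto. intros n _. unfold P. f_equal. lia. }
  destruct (excluded_middle_informative (forall k, z <> (% (- INR k)))) as [Hn|Hn].
  - destruct (product_cv_nonzero P r K) as [l [Hl Hl0]]; auto.
    + unfold P, gauss_seq. unfold Complex.Cdiv. apply Cmult_neq_0; [now apply poch_neq_0|].
      intros E.
      assert (D : (# (fact (S (0 + N))) * Cnatpow (S (0 + N)) z)%C <> 0%C)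
        by (apply Cmult_neq_0; [apply fact_C_neq_0 | apply Cexp_neq_0]).
      assert (E1 := Cinv_r _ D). rewrite E in E1. apply (f_equal fst) in E1. simpl in E1. lra.
    + exists l. auto.
  - destruct (product_cv P r K) as [l Hl]; auto. exists l. split; [now apply S1 | contradiction].
Qed.

(** Convergence makes the [epsilon] in [rGamma] a genuine limit, and uniqueness of limits transfers
    the nonvanishing to it. *)
Lemma rGamma_spec (z : ℂ) :
  is_lim (gauss_seq z) (rGamma z) /\ ((forall k, z <> (% (- INR k))) -> (rGamma z : ℂ) <> 0%C).
Proof.
  destruct (gauss_seq_cv z) as [l [Hl H0]].
  assert (E : rgamma_lim z (rGamma z)) by (apply (epsilon_spec (inhabits CC0) (rgamma_lim z)); exists l; exact Hl).
  split; [exact E|]. intros H. rewrite (Cseq_cv_unique _ _ _ E Hl). auto.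
Qed.

(** * The weighted partial sums *)

Local Arguments INR : simpl never.

Fixpoint csum (f : nat -> ℂ) (M : nat) : ℂ :=
  match M with O => Complex.RtoC 0 | S m => (csum f m + f m)%C end.

(** This is (-1)^n (v)_n / n!, the coefficient of x^n in (1 + x)^(-v). *)
Fixpoint cf (v : ℂ) (n : nat) : ℂ :=
  match n with O => Complex.RtoC 1 | S m => (- (cf v m * (v + # m)) / (# m + 1))%C end.

(** The weights w_k(n), that is (-1)^n (-k)_n / (1+v+k)_n: they vanish for n > k and, for fixed n,
    tend to 1 as k grows. *)
Fixpoint wgt (v : ℂ) (k n : nat) : ℂ :=
  match n with
  | O => Complex.RtoC 1
  | S m => (wgt v k m * (# k - # m) / (1 + v + # k + # m))%C
  end.

Definition pole_pair (s t : ℂ) (n : nat) : ℂ := (/ (# n + s) + / (# n + t))%C.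

(** X_k, given by its recurrence in k, which is that of [wsum_step] without the boundary term. *)
Fixpoint gauss_quot (v s t : ℂ) (k : nat) : ℂ :=
  match k with
  | O => (v / (s * t))%C
  | S j => (gauss_quot v s t j * ((# j + 1) * (v + # j + 1)) / ((s + # j + 1) * (t + # j + 1)))%C
  end.

Lemma csum_S f M : csum f (S M) = (csum f M + f M)%C.
Proof. reflexivity. Qed.

Lemma csum_ext f g M : (forall n, (n < M)%nat -> f n = g n) -> csum f M = csum g M.
Proof.
  induction M as [|M IH]; intros H; simpl; [reflexivity|].
  rewrite IH, H by (intros; try apply H; lia). reflexivity.
Qed.

Lemma csum_cv (f : nat -> nat -> ℂ) (g : nat -> ℂ) M :
  (forall n, is_lim (fun k => f k n) (g n)) -> is_lim (fun k => csum (f k) M) (csum g M).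
Proof.
  intros H. induction M as [|M IH]; simpl; [apply Cseq_cv_const | now apply Cseq_cv_plus].
Qed.

Lemma INR_C_S_neq_0 n : (# n + 1 <> 0)%C.
Proof. rewrite <- INR_C_S. apply INR_C_neq_0. lia. Qed.

Lemma wgt_diag v k : wgt v k (S k) = 0%C.
Proof. simpl. unfold Complex.Cdiv. ring. Qed.

(** The products for k + 1 and k differ only in boundary factors; their quotient is cross-multiplied
    so that it also holds at n = k + 1, where both sides vanish. *)
Lemma wgt_step v k n :
  (forall j, v + # j + 1 <> 0)%C ->
  (wgt v (S k) n * ((# k + 1 - # n) * (v + # k + 1 + # n)) =
   (# k + 1) * (v + # k + 1) * wgt v k n)%C.
Proof.
  intros Hv. induction n as [|n IH].
  - change (# 0) with (Complex.RtoC 0). simpl. ring.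
  - assert (H1 := Hv (k + n)%nat). assert (H2 := Hv (S k + n)%nat).
    rewrite plus_INR, RtoC_plus in H1, H2. rewrite INR_C_S in H2.
    simpl wgt. rewrite !INR_C_S.
    assert (H3 : (1 + v + (# k + 1) + # n <> 0)%C)
      by (intros E; apply H2; rewrite <- E; ring).
    assert (H4 : (1 + v + # k + # n <> 0)%C) by (intros E; apply H1; rewrite <- E; ring).
    replace (v + # k + 1 + (# n + 1))%C with (1 + v + (# k + 1) + # n)%C by ring.
    transitivity (wgt v (S k) n * ((# k + 1 - # n) * (v + # k + 1 + # n)) *
      ((# k - # n) / (1 + v + # k + # n)))%C.
    + field. auto.
    + rewrite IH. field. auto.
Qed.

(** Indefinite summation in Gosper's sense: the right-hand side is 0 at M = 0 and its increment in M
    is the summand. It supplies the inhomogeneous term of the WZ pair. *)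
Lemma wgt_sum v k M :
  (forall j, v + # j + 1 <> 0)%C ->
  csum (fun n => cf v n * wgt v (S k) n * (2 * # n + v))%C M =
  (- (# M * (# k + 1 + v + # M)) / (# k + 1) * cf v M * wgt v (S k) M)%C.
Proof.
  intros Hv. assert (Hk := INR_C_S_neq_0 k). induction M as [|M IH].
  - change (# 0) with (Complex.RtoC 0). simpl. field. auto.
  - simpl csum. rewrite IH. simpl cf. simpl wgt. rewrite !INR_C_S.
    assert (H2 := Hv (S k + M)%nat). rewrite plus_INR, RtoC_plus, INR_C_S in H2.
    assert (H3 : (1 + v + (# k + 1) + # M <> 0)%C)
      by (intros E; apply H2; rewrite <- E; ring).
    assert (HM := INR_C_S_neq_0 M). field. auto.
Qed.

Section Weighted.
Variables (v s t : ℂ).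
Hypothesis Hst : (s + t = v)%C.
Hypothesis Hv : forall j, (v + # j + 1 <> 0)%C.
Hypothesis Hs : forall j, (# j + s <> 0)%C.
Hypothesis Ht : forall j, (# j + t <> 0)%C.

Definition wsum (M k : nat) : ℂ := csum (fun n => cf v n * wgt v k n * pole_pair s t n)%C M.

(** Rests on (s+k+1)(t+k+1) = (k+1-n)(v+k+1+n) + (n+s)(n+t), valid since s + t = v: [wgt_step]
    absorbs the first product, and the second clears the poles, leaving 2n + v for [wgt_sum]. *)
Lemma wsum_step M k :
  ((s + # k + 1) * (t + # k + 1) * wsum M (S k) =
   (# k + 1) * (v + # k + 1) * wsum M k +
   - (# M * (# k + 1 + v + # M)) / (# k + 1) * cf v M * wgt v (S k) M)%C.
Proof.
  rewrite <- wgt_sum by auto. unfold wsum. induction M as [|M IH]; simpl csum; [ring|].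
  rewrite Cmult_plus_distr_l, IH.
  assert (W := wgt_step v k M Hv).
  replace ((s + # k + 1) * (t + # k + 1) * (cf v M * wgt v (S k) M * pole_pair s t M))%C
    with (cf v M * (wgt v (S k) M * ((# k + 1 - # M) * (v + # k + 1 + # M))) * pole_pair s t M +
          cf v M * wgt v (S k) M * (2 * # M + v))%C.
  - rewrite W. ring.
  - unfold pole_pair. rewrite <- Hst. field. auto.
Qed.

Lemma step_denom_neq_0 k : ((s + # k + 1) * (t + # k + 1) <> 0)%C.
Proof.
  assert (A := Hs (S k)). assert (B := Ht (S k)). rewrite INR_C_S in A, B.
  apply Cmult_neq_0; intros E; [apply A | apply B]; rewrite <- E; ring.
Qed.

(** At M = k + 2 the boundary term of [wsum_step] contains w_(k+1)(k+2) = 0, so the full sum obeys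
    the recurrence of X_k. *)
Lemma wsum_diag k : wsum (S k) k = gauss_quot v s t k.
Proof.
  induction k as [|k IH].
  - assert (A := Hs O). assert (B := Ht O). change (# 0) with (Complex.RtoC 0) in A, B.
    unfold wsum, pole_pair. simpl. change (# 0) with (Complex.RtoC 0). rewrite <- Hst.
    field. rewrite Cplus_0_l in A, B. auto.
  - assert (D := step_denom_neq_0 k).
    assert (E := wsum_step (S (S k)) k). rewrite wgt_diag in E.
    assert (E2 : wsum (S (S k)) k = wsum (S k) k).
    { unfold wsum. rewrite (csum_S _ (S k)), wgt_diag. ring. }
    rewrite E2, IH in E. simpl gauss_quot.
    transitivity (((s + # k + 1) * (t + # k + 1) * wsum (S (S k)) (S k)) /
      ((s + # k + 1) * (t + # k + 1)))%C.
    + field. split; intros Z; apply D; rewrite Z; ring.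
    + rewrite E. unfold Complex.Cdiv. ring.
Qed.

(** * Growth of the truncation defect E_k *)

Definition werr (M k : nat) : ℂ := (wsum M k - gauss_quot v s t k)%C.

(** X_k solves the homogeneous recurrence, so the boundary term of [wsum_step] carries over
    unchanged. *)
Lemma werr_step M k :
  ((s + # k + 1) * (t + # k + 1) * werr M (S k) =
   (# k + 1) * (v + # k + 1) * werr M k +
   - (# M * (# k + 1 + v + # M)) / (# k + 1) * cf v M * wgt v (S k) M)%C.
Proof.
  unfold werr. assert (D := step_denom_neq_0 k).
  unfold Cminus at 1. rewrite Cmult_plus_distr_l, wsum_step. simpl gauss_quot.
  field. split; [|split]; try apply INR_C_S_neq_0; intros Z; apply D; rewrite Z; ring.
Qed.

Lemma Cmod_INR_S k : norm (# k + 1) = INR k + 1.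
Proof. rewrite <- INR_C_S, Cmod_R, Rabs_pos_eq by apply pos_INR. now rewrite S_INR. Qed.

Lemma Cmod_shift_ge (z : ℂ) k : INR k + 1 + fst z <= norm (z + # k + 1).
Proof.
  eapply Rle_trans; [|apply (fst_le_Cmod (z + # k + 1)%C)].
  eapply Rle_trans; [|apply Rle_abs]. simpl. lra.
Qed.

Lemma Cmod_shift_ge' (z : ℂ) k : INR k + 1 - norm z <= norm (z + # k + 1).
Proof.
  assert (T := Cmod_triangle_rev (# k + 1) z). rewrite Cmod_INR_S in T.
  replace (# k + 1 + z)%C with (z + # k + 1)%C in T by ring. lra.
Qed.

(* The telescoping identity (w_k - w_(k-1)) k (k+v) = w_k M (M+v), in absolute values. *)
Lemma wgt_increment M k :
  (M <= S k)%nat -> 2 * norm v <= INR M ->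
  norm (wgt v (S k) M) * INR M ^ 2 <=
  4 * (INR k + 1) ^ 2 * (norm (wgt v (S k) M) - norm (wgt v k M)).
Proof.
  intros HM HvM.
  assert (W := f_equal norm (wgt_step v k M Hv)).
  rewrite !Cmod_mult, Cmod_INR_S in W.
  assert (Hm : INR M <= INR k + 1) by (rewrite <- S_INR; now apply le_INR).
  assert (Wd : norm (# k + 1 - # M) = INR k + 1 - INR M).
  { rewrite <- INR_C_S, <- RtoC_minus, Cmod_R, S_INR. rewrite Rabs_pos_eq; lra. }
  rewrite Wd in W. clear Wd.
  set (b := norm (v + # k + 1 + # M)) in *.
  set (q := INR k + 1) in *. set (m := INR M) in *.
  set (w1 := norm (wgt v (S k) M)) in *. set (w0 := norm (wgt v k M)) in *.
  assert (P1 : 0 <= w1) by apply Cmod_ge_0. assert (P0 : 0 <= w0) by apply Cmod_ge_0.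
  assert (Pv := Cmod_ge_0 v).
  assert (Hx : - norm v <= fst v) by (assert (T := fst_le_Cmod v); apply Rabs_le_between in T; lra).
  set (a := norm (v + # k + 1)) in *.
  assert (Ha : q + fst v <= a) by (apply Cmod_shift_ge).
  assert (Ha2 : a <= 2 * q).
  { unfold a. replace (v + # k + 1)%C with (v + (# k + 1))%C by ring.
    eapply Rle_trans; [apply Cmod_triangle|]. rewrite Cmod_INR_S. fold q. lra. }
  assert (Hb : b <= a + m).
  { unfold b. eapply Rle_trans; [apply Cmod_triangle|]. rewrite Cmod_R, Rabs_pos_eq by apply pos_INR.
    fold m a. lra. }
  assert (Hq : 0 < q) by apply INR_S_pos.
  (* Using b <= a + m, the right-hand side is at least m (a - q + m), and a - q >= Re v >= -m/2. *)
  assert (I1 : m * (m / 2) <= q * a - (q - m) * b).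
  { assert ((q - m) * b <= (q - m) * (a + m)) by (apply Rmult_le_compat_l; lra).
    assert (0 <= m) by apply pos_INR.
    assert (m * (m / 2) <= m * (a - q + m)) by (apply Rmult_le_compat_l; lra). nra. }
  assert (I2 : w1 * (m * (m / 2)) <= (q * a) * (w1 - w0)).
  { replace (q * a * (w1 - w0)) with (w1 * (q * a - (q - m) * b)) by lra.
    now apply Rmult_le_compat_l. }
  assert (0 <= m) by apply pos_INR.
  (* The moduli of the weights increase in k; the case a = 0 is excluded because it would force q <=
     m/2, while m <= q. *)
  assert (Hd : 0 <= w1 - w0).
  { assert (0 <= w1 * (m * (m / 2))) by (apply Rmult_le_pos; nra).
    destruct (Rle_dec 0 (w1 - w0)) as [|n]; auto.
    assert (0 <= q * a) by nra.
    destruct (Req_dec (q * a) 0) as [E|E].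
    - assert (w1 * (m * (m / 2)) <= 0) by (rewrite E in I2; lra).
      exfalso. assert (a = 0) by nra.
      assert (q <= m / 2) by lra. lra.
    - nra. }
  assert ((q * a) * (w1 - w0) <= (q * (2 * q)) * (w1 - w0)).
  { apply Rmult_le_compat_r; auto. apply Rmult_le_compat_l; lra. }
  nra.
Qed.

(** The factor 48 is 3 * 4 * 4: from |k+1+v+M| <= 3(k+1), from the lower bound (k+1)^2/4 for the
    modulus of (s+k+1)(t+k+1), and from [wgt_increment]. *)
Definition err_coef (M : nat) : R := 48 * (norm (cf v M) / INR M).

(** Divide [werr_step] by A = (s+k+1)(t+k+1): as (k+1)(v+k+1) = A - s t, the homogeneous factor is 1
    + O(1/k^2), and [wgt_increment] turns the boundary term into an increment of |w_k(M)|. *)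
Lemma werr_growth M k :
  (0 < M)%nat -> (M <= S k)%nat -> 2 * norm v <= INR M -> 2 * norm s <= INR M -> 2 * norm t <= INR M ->
  norm (werr M (S k)) <= (1 + 4 * (norm s * norm t) / (INR k + 1) ^ 2) * norm (werr M k) +
    err_coef M * (norm (wgt v (S k) M) - norm (wgt v k M)).
Proof.
  intros H0 HM Hv2 Hs2 Ht2.
  assert (WI := wgt_increment M k HM Hv2).
  assert (ST := werr_step M k).
  assert (HMk : INR M <= INR k + 1) by (rewrite <- S_INR; now apply le_INR).
  assert (As := Cmod_shift_ge' s k). assert (At := Cmod_shift_ge' t k).
  assert (Hm : 0 < INR M) by now apply lt_0_INR.
  assert (Nk := INR_C_S_neq_0 k).
  set (A := ((s + # k + 1) * (t + # k + 1))%C) in *.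
  set (q := INR k + 1) in *. set (m := INR M) in *.
  set (w1 := norm (wgt v (S k) M)) in *. set (w0 := norm (wgt v k M)) in *.
  assert (Hq : 0 < q) by apply INR_S_pos.
  assert (HA : q ^ 2 / 4 <= norm A).
  { unfold A. rewrite Cmod_mult. replace (q ^ 2 / 4) with (q / 2 * (q / 2)) by field.
    apply Rmult_le_compat; lra. }
  assert (Hqv : norm ((# k + 1) * (v + # k + 1)) <= norm A + norm s * norm t).
  { replace ((# k + 1) * (v + # k + 1))%C with (A + - (s * t))%C by (unfold A; rewrite <- Hst; ring).
    eapply Rle_trans; [apply Cmod_triangle|]. rewrite Cmod_opp, Cmod_mult. lra. }
  assert (Hkv : norm (# k + 1 + v + # M) <= 3 * q).
  { eapply Rle_trans; [apply Cmod_triangle|].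
    eapply Rle_trans; [apply Rplus_le_compat_r, Cmod_triangle|].
    rewrite Cmod_INR_S, Cmod_R, Rabs_pos_eq by apply pos_INR. fold q m. lra. }
  assert (HT : norm (- (# M * (# k + 1 + v + # M)) / (# k + 1) * cf v M * wgt v (S k) M)
                <= 3 * m * norm (cf v M) * w1).
  { rewrite !Cmod_mult, Cmod_div, Cmod_opp, Cmod_mult, Cmod_INR_S by auto.
    rewrite Cmod_R, Rabs_pos_eq by apply pos_INR. fold q m w1.
    apply Rmult_le_compat_r; [apply Cmod_ge_0|]. apply Rmult_le_compat_r; [apply Cmod_ge_0|].
    apply Rmult_le_reg_r with q; auto. unfold Rdiv. rewrite Rmult_assoc, Rinv_l by lra.
    assert (Z := Rmult_le_compat_l m _ _ ltac:(lra) Hkv). fold m in Z. lra. }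
  set (c := norm (cf v M)) in *. assert (Hc : 0 <= c) by apply Cmod_ge_0.
  assert (E : norm A * norm (werr M (S k)) <=
    (norm A + norm s * norm t) * norm (werr M k) + 3 * m * c * w1).
  { rewrite <- Cmod_mult, ST. eapply Rle_trans; [apply Cmod_triangle|].
    apply Rplus_le_compat; auto. rewrite Cmod_mult.
    apply Rmult_le_compat_r; auto using Cmod_ge_0. }
  assert (Hst0 : 0 <= norm s * norm t) by (apply Rmult_le_pos; apply Cmod_ge_0).
  assert (q2 : 0 < q ^ 2) by (apply pow_lt; lra).
  apply Rmult_le_reg_l with (norm A); [lra|].
  eapply Rle_trans; [exact E|]. rewrite Rmult_plus_distr_l.
  apply Rplus_le_compat.
  - rewrite <- Rmult_assoc. apply Rmult_le_compat_r; [apply Cmod_ge_0|].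
    assert (norm s * norm t <= norm A * (4 * (norm s * norm t) / q ^ 2)); [|lra].
    replace (norm s * norm t) with (q ^ 2 / 4 * (4 * (norm s * norm t) / q ^ 2)) at 1 by (field; lra).
    apply Rmult_le_compat_r; auto. apply Rmult_le_pos; [lra|]. left. now apply Rinv_0_lt_compat.
  - assert (Hd : 0 <= w1 - w0).
    { assert (0 <= w1 * m ^ 2) by (apply Rmult_le_pos; [apply Cmod_ge_0 | nra]). nra. }
    unfold err_coef. fold c m.
    apply Rle_trans with (q ^ 2 / 4 * (48 * (c / m) * (w1 - w0))).
    + replace (3 * m * c * w1) with (3 * (c / m) * (w1 * m ^ 2)) by (field; lra).
      replace (q ^ 2 / 4 * (48 * (c / m) * (w1 - w0)))
        with (3 * (c / m) * (4 * q ^ 2 * (w1 - w0))) by (field; lra).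
      apply Rmult_le_compat_l; auto.
      assert (0 <= c / m) by (apply Rdiv_le_0_compat; lra). lra.
    + apply Rmult_le_compat_r; auto. apply Rmult_le_pos; auto.
      assert (0 <= c / m) by (apply Rdiv_le_0_compat; lra). lra.
Qed.

(** Accumulated homogeneous growth, bounded uniformly in i through [growth_le_exp]. *)
Fixpoint amplification (i : nat) : R :=
  match i with
  | O => 1
  | S i => amplification i * (1 + 4 * (norm s * norm t) / (INR i + 1) ^ 2)
  end.

Lemma amplification_S i :
  amplification (S i) = amplification i * (1 + 4 * (norm s * norm t) / (INR i + 1) ^ 2).
Proof. reflexivity. Qed.

Lemma amplification_bounds i : 1 <= amplification i <= exp (2 * (4 * (norm s * norm t))).
Proof.
  assert (Hst0 : 0 <= 4 * (norm s * norm t)) by (assert (H1 := Cmod_ge_0 s); assert (H2 := Cmod_ge_0 t); nra).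
  assert (H1 : forall i, 1 <= amplification i).
  { induction i0 as [|j IH]; [simpl; lra | rewrite amplification_S].
    assert (0 <= 4 * (norm s * norm t) / (INR j + 1) ^ 2)
      by (apply Rdiv_le_0_compat; [auto | apply pow_lt, INR_S_pos]). nra. }
  split; auto.
  rewrite <- (Rmult_1_l (exp _)). change 1 with (amplification 0).
  apply growth_le_exp; auto.
  - intros n. specialize (H1 n). lra.
  - intros n. rewrite amplification_S. lra.
Qed.

(** The induction starts at k = m = M - 1, where the defect is zero by [wsum_diag]; the
    inhomogeneous increments then telescope to |w_k(M)|, up to the factor [amplification]. *)
Lemma werr_bound m i :
  2 * norm v <= INR (S m) -> 2 * norm s <= INR (S m) -> 2 * norm t <= INR (S m) ->
  norm (werr (S m) (m + i)) <=
    exp (2 * (4 * (norm s * norm t))) * err_coef (S m) * norm (wgt v (m + i) (S m)).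
Proof.
  intros H1 H2 H3.
  assert (B0 : 0 <= err_coef (S m)).
  { unfold err_coef. apply Rmult_le_pos; [lra|]. apply Rdiv_le_0_compat; [apply Cmod_ge_0|].
    apply lt_0_INR. lia. }
  assert (A : norm (werr (S m) (m + i)) <=
     amplification i * err_coef (S m) * norm (wgt v (m + i) (S m))).
  { induction i as [|i IH].
    - rewrite Nat.add_0_r. unfold werr. rewrite wsum_diag, wgt_diag, Cmod_0.
      unfold Cminus. rewrite Cplus_opp_r, Cmod_0. lra.
    - replace (m + S i)%nat with (S (m + i)) by lia.
      eapply Rle_trans; [apply werr_growth; auto; lia|].
      assert (WI := wgt_increment (S m) (m + i) ltac:(lia) H1).
      set (w1 := norm (wgt v (S (m + i)) (S m))) in *. set (w0 := norm (wgt v (m + i) (S m))) in *.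
      assert (P1 : 0 <= w1) by apply Cmod_ge_0.
      assert (P0 : 0 <= w0) by apply Cmod_ge_0.
      assert (Hq : 0 < (INR (m + i) + 1) ^ 2) by (apply pow_lt, INR_S_pos).
      assert (Hd : 0 <= w1 - w0).
      { assert (0 <= w1 * INR (S m) ^ 2) by (apply Rmult_le_pos; [auto | apply pow2_ge_0]). nra. }
      destruct (amplification_bounds (S i)) as [Q1 _]. destruct (amplification_bounds i) as [Q0 _].
      set (Q := amplification i) in *.
      assert (G : (1 + 4 * (norm s * norm t) / (INR (m + i) + 1) ^ 2) * norm (werr (S m) (m + i))
        <= amplification (S i) * err_coef (S m) * w0).
      (* The growth factor at k = m + i is replaced by the larger one at i, which makes the final
         constant independent of m. *)
      { apply Rle_trans with ((1 + 4 * (norm s * norm t) / (INR i + 1) ^ 2) * (Q * err_coef (S m) * w0)).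
        - assert (Hst0 : 0 <= 4 * (norm s * norm t))
            by (assert (Z1 := Cmod_ge_0 s); assert (Z2 := Cmod_ge_0 t); nra).
          apply Rmult_le_compat; auto using Cmod_ge_0.
          + assert (0 <= 4 * (norm s * norm t) / (INR (m + i) + 1) ^ 2)
              by (apply Rdiv_le_0_compat; auto). lra.
          + apply Rplus_le_compat_l. apply Rmult_le_compat_l; auto.
            apply Rinv_le_contravar; [apply pow_lt, INR_S_pos|].
            apply pow_incr. rewrite plus_INR. assert (Z := pos_INR m). assert (Z' := pos_INR i). lra.
        - rewrite amplification_S. fold Q. right. ring. }
      assert (err_coef (S m) * (w1 - w0) <= amplification (S i) * (err_coef (S m) * (w1 - w0))).
      { assert (0 <= err_coef (S m) * (w1 - w0)) by (apply Rmult_le_pos; auto). nra. }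
      lra. }
  eapply Rle_trans; [exact A|].
  apply Rmult_le_compat_r; [apply Cmod_ge_0|]. apply Rmult_le_compat_r; auto.
  apply amplification_bounds.
Qed.

End Weighted.

(** * The alternating beta sum *)

Lemma inv_INR_C_lim (z : ℂ) : is_lim (fun k => (z / # (S k))%C) (Complex.RtoC 0).
Proof.
  apply (Cseq_cv_dist _ _ (fun k => norm z * / (INR k + 1)) 0).
  - intros k _. replace (z / # (S k) - 0)%C with (z / # (S k))%C by ring.
    rewrite INR_C_S, Cmod_div, Cmod_INR_S by apply INR_C_S_neq_0. lra.
  - replace 0 with (norm z * 0) by ring. apply (is_lim_seq_scal_l _ _ 0), inv_INR_S_lim.
Qed.

Lemma wgt_lim (v : ℂ) n :
  (forall j, v + # j + 1 <> 0)%C -> is_lim (fun k => wgt v k n) (Complex.RtoC 1).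
Proof.
  intros Hv. induction n as [|n IH]; [exact (Cseq_cv_const (Complex.RtoC 1))|].
  replace (Complex.RtoC 1) with (1 * ((1 - 0) * / (1 + 0)))%C by (field; intros E; apply (f_equal fst) in E; simpl in E; lra).
  apply (Cseq_cv_ext (fun k => wgt v k n * ((# k - # n) / (1 + v + # k + # n)))%C _ _ 0).
  { intros k _. simpl. unfold Complex.Cdiv. ring. }
  apply Cseq_cv_mult; auto.
  (* From index k + 1 on, numerator and denominator can be divided by a nonzero integer. *)
  apply (Cseq_cv_shift _ _ 1).
  apply (Cseq_cv_ext (fun k => ((1 - # n / # (S k)) * / (1 + (1 + v + # n) / # (S k))))%C _ _ 0).
  - intros k _. rewrite Nat.add_1_r. assert (H := Hv (S k + n)%nat).
    rewrite plus_INR, RtoC_plus in H. assert (H' := INR_C_S_neq_0 k). rewrite <- INR_C_S in H'.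
    assert (H2 : (1 + v + # (S k) + # n <> 0)%C) by (intros E; apply H; rewrite <- E; ring).
    field. auto.
  - apply Cseq_cv_mult.
    + apply Cseq_cv_minus; [apply Cseq_cv_const | apply inv_INR_C_lim].
    + apply (Cseq_cv_inv (fun k => 1 + (1 + v + # n) / # (S k))%C).
      * intros E; apply (f_equal fst) in E; simpl in E; lra.
      * apply Cseq_cv_plus; [apply Cseq_cv_const | apply inv_INR_C_lim].
Qed.

Lemma cf_poch (v : ℂ) n :
  (cf v n * # (fact n))%C = (Defs.Cpow (% (-1)) n * poch v n)%C.
Proof.
  induction n as [|n IH]; [apply Cpair_eq; simpl; unfold INR; ring|].
  rewrite fact_C_S, poch_S. change (Defs.Cpow (% (-1)) (S n)) with (% (-1) * Defs.Cpow (% (-1)) n)%C.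
  simpl cf. assert (H := INR_C_S_neq_0 n).
  transitivity (- (v + # n) * (cf v n * # (fact n)))%C.
  - field. auto.
  - rewrite IH. replace (% (-1)) with (- (1))%C at 2 by (apply Cpair_eq; simpl; ring). ring.
Qed.

Lemma Cmod_cf (v : ℂ) n : norm (cf v n) * INR (fact n) = norm (poch v n).
Proof.
  assert (H := f_equal norm (cf_poch v n)).
  rewrite !Cmod_mult, Cmod_R, Rabs_pos_eq in H by apply pos_INR. rewrite H.
  assert (P : norm (Defs.Cpow (% (-1)) n) = 1).
  { induction n as [|n IH]; [apply Cmod_1|].
    change (Defs.Cpow (% (-1)) (S n)) with (% (-1) * Defs.Cpow (% (-1)) n)%C.
    rewrite Cmod_mult, Cmod_R, Rabs_left by lra. rewrite IH; [lra|].
    assert (H' := f_equal norm (cf_poch v n)).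
    now rewrite !Cmod_mult, Cmod_R, Rabs_pos_eq in H' by apply pos_INR. }
  rewrite P. lra.
Qed.

Lemma Cmod_Cnatpow n (z : ℂ) : norm (Cnatpow n z) = exp (fst z * ln (INR n)).
Proof. unfold Cnatpow. rewrite Cmod_Cexp. f_equal. simpl. ring. Qed.

Lemma gauss_seq_poch (z : ℂ) n :
  poch z (S n) = (gauss_seq z n * (# (fact n) * Cnatpow n z))%C.
Proof.
  unfold gauss_seq. assert (H := Cexp_neq_0 (z * % (ln (INR n)))%C).
  change (Cexp _) with (Cnatpow n z) in H. assert (H' := fact_C_neq_0 n).
  assert (E : (poch z (S n) / (# (fact n) * Cnatpow n z) * (# (fact n) * Cnatpow n z))%C = poch z (S n))
    by (field; auto).
  now symmetry.
Qed.

(** By Gauss' limit |cf v (m+1)| (m+1) = |g_m| m^(Re v) with g_m convergent, so the quotient is at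
    most |g_m| m^(Re v - 2); here Re v < 2 enters. *)
Lemma cf_decay (v : ℂ) :
  fst v < 2 -> is_lim_seq (fun m => norm (cf v (S m)) / INR (S m)) 0.
Proof.
  intros Hv. destruct (rGamma_spec v) as [G _]. apply Cseq_cv_Cmod in G.
  assert (L : is_lim_seq (fun m => exp ((fst v - 2) * ln (INR m))) 0).
  { apply (is_lim_comp_seq exp _ m_infty 0); [apply is_lim_exp_m | |].
    - exists O. intros; discriminate.
    - apply (is_lim_seq_mult (fun _ => fst v - 2) (fun m => ln (INR m)) (fst v - 2) p_infty).
      + apply is_lim_seq_const.
      + apply (is_lim_comp_seq ln _ p_infty p_infty); [apply is_lim_ln_p | | apply is_lim_seq_INR].
        exists O. intros; discriminate.
      + apply is_Rbar_mult_sym, is_Rbar_mult_p_infty_neg. simpl. lra. }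
  apply (is_lim_seq_le_le_loc (fun _ => 0) _
    (fun m => norm (gauss_seq v m) * exp ((fst v - 2) * ln (INR m)))).
  - exists 1%nat. intros m Hm. split.
    + apply Rdiv_le_0_compat; [apply Cmod_ge_0 | apply lt_0_INR; lia].
    + assert (C := Cmod_cf v (S m)). rewrite gauss_seq_poch, !Cmod_mult, Cmod_Cnatpow in C.
      rewrite Cmod_R, Rabs_pos_eq in C by apply pos_INR.
      change (fact (S m)) with (S m * fact m)%nat in C. rewrite mult_INR in C.
      assert (Hf : 0 < INR (fact m)) by apply INR_fact_lt_0.
      assert (Hm0 : 0 < INR m) by (apply lt_0_INR; lia).
      assert (HS : INR (S m) = INR m + 1) by apply S_INR. rewrite HS in *.
      set (q := INR m + 1) in *. set (c := norm (cf v (S m))) in *. set (g := norm (gauss_seq v m)) in *.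
      assert (E : exp (fst v * ln (INR m)) = exp ((fst v - 2) * ln (INR m)) * INR m ^ 2).
      { replace (INR m ^ 2) with (exp (ln (INR m)) * exp (ln (INR m))) by (rewrite exp_ln by auto; ring).
        rewrite <- !exp_plus. f_equal. ring. }
      assert (C' : c * q = g * exp (fst v * ln (INR m))) by (apply Rmult_eq_reg_r with (INR (fact m)); lra).
      rewrite E in C'. set (e := exp ((fst v - 2) * ln (INR m))) in *.
      assert (He : 0 < e) by apply exp_pos. assert (Hg : 0 <= g) by apply Cmod_ge_0.
      assert (Hq : INR m < q) by (unfold q; lra).
      apply Rmult_le_reg_r with (q ^ 2); [nra|].
      replace (c / q * q ^ 2) with (c * q) by (field; lra). rewrite C'.
      assert (0 <= g * e) by nra. assert (INR m ^ 2 <= q ^ 2) by nra. nra.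
  - apply is_lim_seq_const.
  - replace 0 with (norm (rGamma v) * 0) by ring. now apply is_lim_seq_mult'.
Qed.

Lemma gauss_quot_poch (v s t : ℂ) k :
  (forall j, # j + s <> 0)%C -> (forall j, # j + t <> 0)%C ->
  gauss_quot v s t k = (poch v (S k) * # (fact k) / (poch s (S k) * poch t (S k)))%C.
Proof.
  intros Hs Ht.
  assert (P : forall z : ℂ, (forall j, # j + z <> 0)%C -> forall n, poch z n <> (0 : ℂ)%C).
  { intros z Hz n. apply poch_neq_0. intros j E. apply (Hz j). rewrite E.
    apply Cpair_eq; simpl; ring. }
  induction k as [|k IH].
  - simpl gauss_quot. assert (A := Hs O). assert (B := Ht O).
    change (# 0) with (Complex.RtoC 0) in A, B. rewrite Cplus_0_l in A, B.
    rewrite !poch_S. change (# 0) with (Complex.RtoC 0).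
    replace (# (fact 0)) with (Complex.RtoC 1) by reflexivity.
    change (poch v 0) with (Complex.RtoC 1). change (poch s 0) with (Complex.RtoC 1).
    change (poch t 0) with (Complex.RtoC 1).
    field. auto.
  - simpl gauss_quot. rewrite IH, (poch_S v (S k)), (poch_S s (S k)), (poch_S t (S k)), fact_C_S, INR_C_S.
    assert (A := Hs (S k)). assert (B := Ht (S k)). rewrite INR_C_S in A, B.
    assert (A' : (s + (# k + 1) <> 0)%C) by (intros E; apply A; rewrite <- E; ring).
    assert (B' : (t + (# k + 1) <> 0)%C) by (intros E; apply B; rewrite <- E; ring).
    assert (PS := P s Hs (S k)). assert (PT := P t Ht (S k)).
    field. auto.
Qed.

Lemma notin_poles (z : ℂ) : (forall j, # j + z <> 0)%C -> forall k, z <> (% (- INR k)).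
Proof.
  intros H k E. apply (H k). rewrite E. apply Cpair_eq; simpl; ring.
Qed.

(** X_k is the Gauss sequence of v divided by those of s and t: since s + t = v, the powers of k
    cancel. *)
Lemma gauss_quot_lim (v s t : ℂ) :
  (s + t = v)%C -> (forall j, # j + s <> 0)%C -> (forall j, # j + t <> 0)%C ->
  is_lim (gauss_quot v s t) ((rGamma v : ℂ) * ((/ (rGamma s : ℂ)) * (/ (rGamma t : ℂ))))%C.
Proof.
  intros Hst Hs Ht.
  destruct (rGamma_spec v) as [Gv _].
  destruct (rGamma_spec s) as [Gs Ns]. destruct (rGamma_spec t) as [Gt Nt].
  specialize (Ns (notin_poles s Hs)). specialize (Nt (notin_poles t Ht)).
  apply (Cseq_cv_ext (fun k => gauss_seq v k * (/ gauss_seq s k * / gauss_seq t k))%C _ _ 1).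
  2:{ apply Cseq_cv_mult; auto. apply Cseq_cv_mult; now apply Cseq_cv_inv. }
  intros k _. rewrite gauss_quot_poch by auto.
  assert (PS := poch_neq_0 s (S k) (notin_poles s Hs)).
  assert (PT := poch_neq_0 t (S k) (notin_poles t Ht)).
  unfold gauss_seq. assert (H' := fact_C_neq_0 k).
  assert (E : (Cnatpow k s * Cnatpow k t)%C = Cnatpow k v).
  { unfold Cnatpow. rewrite <- Cexp_plus. rewrite <- Hst. f_equal. apply Cpair_eq; simpl; ring. }
  rewrite <- E.
  assert (E1 := Cexp_neq_0 (s * % (ln (INR k)))%C). change (Cexp _) with (Cnatpow k s) in E1.
  assert (E2 := Cexp_neq_0 (t * % (ln (INR k)))%C). change (Cexp _) with (Cnatpow k t) in E2.
  field. repeat split; auto.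
Qed.

(** For fixed m, letting k tend to infinity in [werr_bound] sends the weights to 1 and bounds the
    distance to the limit by a multiple of |cf v (m+1)|/(m+1), which [cf_decay] controls. The
    condition on v keeps the denominators of the weights nonzero. *)
Lemma beta_sum_generic (v s t : ℂ) :
  (s + t = v)%C -> fst v < 2 -> (forall j, v + # j + 1 <> 0)%C ->
  (forall j, # j + s <> 0)%C -> (forall j, # j + t <> 0)%C ->
  is_lim (fun m => csum (fun n => cf v n * pole_pair s t n)%C (S m))
    ((rGamma v : ℂ) * ((/ (rGamma s : ℂ)) * (/ (rGamma t : ℂ))))%C.
Proof.
  intros Hst Hv2 Hv Hs Ht. assert (GL := gauss_quot_lim v s t Hst Hs Ht).
  set (L := (_ * _)%C) in *.
  set (K := exp (2 * (4 * (norm s * norm t)))).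
  destruct (INR_unbounded (2 * norm v + 2 * norm s + 2 * norm t)) as [N HN].
  apply (Cseq_cv_dist _ _ (fun m => K * (48 * (norm (cf v (S m)) / INR (S m)))) N).
  - intros m Hm.
    assert (HmN : INR N <= INR (S m)) by (apply le_INR; lia).
    assert (Zv := Cmod_ge_0 v). assert (Zs := Cmod_ge_0 s). assert (Zt := Cmod_ge_0 t).
    apply (Cseq_cv_Cmod_le (fun i => werr v s t (S m) (i + m))
       _ (fun i => K * err_coef v (S m) * norm (wgt v (i + m) (S m))) _ 0).
    + intros i _. rewrite (Nat.add_comm i m). apply werr_bound; auto; lra.
    + apply (Cseq_cv_shift (fun k => werr v s t (S m) k)). unfold werr.
      apply Cseq_cv_minus; auto. unfold wsum. apply csum_cv. intros n.
      apply (Cseq_cv_ext (fun k => cf v n * pole_pair s t n * wgt v k n)%C _ _ 0).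
      { intros; ring. }
      assert (W := Cseq_cv_mult _ _ _ _ (Cseq_cv_const (cf v n * pole_pair s t n)) (wgt_lim v n Hv)).
      now rewrite Cmult_1_r in W.
    + replace (K * (48 * (norm (cf v (S m)) / INR (S m)))) with (K * err_coef v (S m) * norm 1)
        by (rewrite Cmod_1; unfold err_coef; ring).
      apply (is_lim_seq_scal_l _ _ (norm 1)).
      apply (Cseq_cv_Cmod (fun i => wgt v (i + m) (S m))).
      apply (Cseq_cv_shift (fun k => wgt v k (S m))). now apply wgt_lim.
  - replace 0 with (K * (48 * 0)) by ring.
    apply (is_lim_seq_scal_l _ _ (48 * 0)%R), (is_lim_seq_scal_l _ _ 0).
    now apply cf_decay.
Qed.

(** * The beta sum at nonpositive integers v *)

Lemma csum_shift f M : csum f (S M) = (f O + csum (fun n => f (S n)) M)%C.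
Proof.
  induction M as [|M IH]; [simpl; ring|]. rewrite csum_S, IH, (csum_S (fun n => f (S n))). ring.
Qed.

Lemma csum_rev f M : csum f M = csum (fun n => f (M - S n)%nat) M.
Proof.
  induction M as [|M IH]; [reflexivity|].
  rewrite csum_S, (csum_shift (fun n => f (S M - S n)%nat)), IH, Cplus_comm.
  replace (S M - 1)%nat with M by lia. reflexivity.
Qed.

Lemma csum_plus f g M : csum (fun n => f n + g n)%C M = (csum f M + csum g M)%C.
Proof. induction M as [|M IH]; simpl; [ring|]. rewrite IH. ring. Qed.

Lemma csum_opp f M : csum (fun n => - f n)%C M = (- csum f M)%C.
Proof. induction M as [|M IH]; simpl; [ring|]. rewrite IH. ring. Qed.

(** At v = -p the coefficient is the binomial coefficient of p over n; the factorial form makes the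
    symmetry n -> p - n visible. *)
Lemma cf_neg_int p n :
  (n <= p)%nat -> (cf (% (- INR p)) n * # (fact n) * # (fact (p - n)))%C = # (fact p).
Proof.
  induction n as [|n IH]; intros H.
  - rewrite Nat.sub_0_r. simpl. replace (# 1) with (Complex.RtoC 1) by reflexivity. ring.
  - rewrite <- IH by lia. replace (p - n)%nat with (S (p - S n)) by lia.
    rewrite !fact_C_S. simpl cf. assert (Hn := INR_C_S_neq_0 n).
    assert (E : (# (p - S n) + 1)%C = (- (% (- INR p) + # n))%C).
    { rewrite minus_INR, S_INR by lia. apply Cpair_eq; simpl; ring. }
    rewrite E. field. auto.
Qed.

Lemma cf_neg_int_sym p n :
  (n <= p)%nat -> cf (% (- INR p)) (p - n) = cf (% (- INR p)) n.
Proof.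
  intros H. assert (A := cf_neg_int p n H). assert (B := cf_neg_int p (p - n) ltac:(lia)).
  replace (p - (p - n))%nat with n in B by lia.
  assert (F1 := fact_C_neq_0 n). assert (F2 := fact_C_neq_0 (p - n)).
  rewrite <- A in B.
  transitivity (cf (% (- INR p)) (p - n) * # (fact (p - n)) * # (fact n) / (# (fact (p - n)) * # (fact n)))%C.
  - field. auto.
  - rewrite B. field. auto.
Qed.

Lemma cf_neg_int_0 p n : (p < n)%nat -> cf (% (- INR p)) n = 0%C.
Proof.
  induction 1 as [|n H IH]; simpl cf.
  - replace (% (- INR p) + # p)%C with (Complex.RtoC 0) by (apply Cpair_eq; simpl; ring).
    unfold Complex.Cdiv. ring.
  - rewrite IH. unfold Complex.Cdiv. ring.
Qed.

(** The factor with index p kills every Pochhammer symbol of length above p. *)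
Lemma rGamma_neg_int p : (rGamma (% (- INR p)) : ℂ) = 0%C.
Proof.
  destruct (rGamma_spec (% (- INR p))) as [G _].
  apply (Cseq_cv_unique _ _ _ G).
  apply (Cseq_cv_ext (fun _ => Complex.RtoC 0) _ _ p); [|apply Cseq_cv_const].
  intros n Hn. unfold gauss_seq.
  assert (E : poch (% (- INR p)) (S n) = (0 : ℂ)%C).
  { induction Hn as [|n Hn IH]; rewrite poch_S.
    - replace (% (- INR p) + # p)%C with (Complex.RtoC 0) by (apply Cpair_eq; simpl; ring).
      apply Cmult_0_r.
    - rewrite IH. apply Cmult_0_l. }
  rewrite E. unfold Complex.Cdiv. ring.
Qed.

(* At [v = - p] both sides vanish: the coefficients are symmetric under [n -> p - n], while
   [1 / (n + s) + 1 / (n + t)] changes sign. *)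
Lemma beta_sum_neg_int p (s t : ℂ) :
  (s + t = % (- INR p))%C ->
  (forall j, # j + s <> 0)%C -> (forall j, # j + t <> 0)%C ->
  is_lim (fun m => csum (fun n => cf (% (- INR p)) n * pole_pair s t n)%C (S m)) (Complex.RtoC 0).
Proof.
  intros Hst Hs Ht. set (v := % (- INR p)) in *.
  assert (Z : csum (fun n => cf v n * pole_pair s t n)%C (S p) = 0%C).
  (* As s + t = -p, one has (p - n) + s = -(n + t): the t-half of the sum is minus the reversal of
     the s-half. *)
  { rewrite (csum_ext _ (fun n => cf v n * / (# n + s) + - (cf v (p - n) * / (# (p - n) + s)))%C).
    - rewrite csum_plus, csum_opp.
      rewrite (csum_rev (fun n => cf v n * / (# n + s))%C).
      replace (fun n => cf v (S p - S n) * / (# (S p - S n) + s))%C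
        with (fun n => cf v (p - n) * / (# (p - n) + s))%C by reflexivity. ring.
    - intros n Hn. unfold v. rewrite cf_neg_int_sym by lia. fold v. unfold pole_pair.
      assert (E : (# (p - n) + s)%C = (- (# n + t))%C).
      { replace s with (v - t)%C by (rewrite <- Hst; ring). rewrite minus_INR by lia.
        unfold v. apply Cpair_eq; simpl; ring. }
      assert (A := Hs n). assert (B := Ht n). rewrite E. field. auto. }
  apply (Cseq_cv_ext (fun _ => Complex.RtoC 0) _ _ p); [|apply Cseq_cv_const].
  intros m Hm. induction Hm as [|m Hm IH]; [now rewrite Z|].
  rewrite csum_S, <- IH. unfold v. rewrite cf_neg_int_0 by lia. ring.
Qed.

(** The weights have vanishing denominators at negative integers v, so nonpositive integers are
    treated separately; there [rGamma v] is 0 and so is the sum. *)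
Lemma beta_sum (v s t : ℂ) :
  (s + t = v)%C -> fst v < 2 -> (forall j, # j + s <> 0)%C -> (forall j, # j + t <> 0)%C ->
  is_lim (fun m => csum (fun n => cf v n * pole_pair s t n)%C (S m))
    ((rGamma v : ℂ) * ((/ (rGamma s : ℂ)) * (/ (rGamma t : ℂ))))%C.
Proof.
  intros Hst Hv2 Hs Ht.
  destruct (excluded_middle_informative (exists p, v = % (- INR p))) as [[p Hp]|Hv].
  - subst v. rewrite Hp in *. rewrite rGamma_neg_int, Cmult_0_l. now apply beta_sum_neg_int.
  - apply beta_sum_generic; auto. intros j E. apply Hv. exists (S j).
    rewrite S_INR. replace v with (v + # j + 1 - (# j + 1))%C by ring. rewrite E.
    apply Cpair_eq; simpl; ring.
Qed.

(** * The hypergeometric series *)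

(* Rewriting with these equations, instead of converting, keeps the kernel from unfolding nested
   products into components. *)
Lemma Cadd_Cplus : Cadd = Cplus. Proof. reflexivity. Qed.
Lemma Csub_Cminus : Csub = Cminus. Proof. reflexivity. Qed.
Lemma Cmul_Cmult : Cmul = Cmult. Proof. reflexivity. Qed.
Lemma Cinv_Cinv : Defs.Cinv = Complex.Cinv. Proof. reflexivity. Qed.
Lemma Cdiv_Cdiv : Defs.Cdiv = Complex.Cdiv. Proof. reflexivity. Qed.
Lemma RtoC_RtoC : Defs.RtoC = Complex.RtoC. Proof. reflexivity. Qed.

(** Both sides are (z)_(n+1). This collapses the quotients of (1+x)_n and (x)_n in the series. *)
Lemma poch_shift (z : ℂ) n : (z * poch (1 + z)%C n)%C = ((z + # n) * poch z n)%C.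
Proof.
  induction n as [|n IH].
  - change (# 0) with (Complex.RtoC 0). change (poch (1 + z)%C 0) with (Complex.RtoC 1).
    change (poch z 0) with (Complex.RtoC 1). ring.
  - rewrite !poch_S, INR_C_S, Cmult_assoc, IH. ring.
Qed.

Lemma Cpartial_csum (u : nat -> ℂ) n : Cpartial u n = csum u (S n).
Proof.
  induction n as [|n IH].
  - symmetry. apply Cplus_0_l.
  - rewrite csum_S, <- IH. reflexivity.
Qed.

Lemma csum_scal (k : ℂ) f M : csum (fun n => k * f n)%C M = (k * csum f M)%C.
Proof. induction M as [|M IH]; simpl; [ring|]. rewrite IH. ring. Qed.

Lemma CC_neq_0_of_fst (z : ℂ) : fst z > 0 -> z <> 0%C.
Proof. intros H E. rewrite E in H. simpl in H. lra. Qed.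

(** The two brackets are 2m/(m^2 - (A+B)^2) and 2m/(m^2 - (A-B)^2); adding them gives the numerator
    4m (m^2 - A^2 - B^2). *)
Lemma term_partial_fractions (m A B : ℂ) :
  (m - A - B <> 0)%C -> (m - A + B <> 0)%C -> (m + A + B <> 0)%C -> (m + A - B <> 0)%C ->
  (m * (m * m - A * A - B * B) / ((m - A - B) * (m - A + B) * (m + A + B) * (m + A - B)) =
   / 4 * ((/ (m - A - B) + / (m + A + B)) + (/ (m - A + B) + / (m + A - B))))%C.
Proof.
  intros. assert (Complex.RtoC 4 <> 0%C) by (intros E; apply (f_equal fst) in E; simpl in E; lra).
  field. repeat split; auto.
Qed.

(** The parameters stand for w = v/2, A = a/(2c), B = b/(2c) and S = sqrt(a^2+b^2)/(2c), in which
    the sigma_j are the four combinations of w with signed A and B. *)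
Lemma hyp_term_partial_fractions (v w l1 l2 A B S : ℂ) n :
  (w + w = v)%C -> (S * S = A * A + B * B)%C -> l1 = (w - S)%C -> l2 = (w + S)%C ->
  let s3 := (w - A - B)%C in let s4 := (w - A + B)%C in
  let s5 := (w + A + B)%C in let s6 := (w + A - B)%C in
  (forall k, w <> (% (- INR k))) -> (forall k, l1 <> (% (- INR k))) -> (forall k, l2 <> (% (- INR k))) ->
  (forall j, # j + s3 <> 0)%C -> (forall j, # j + s4 <> 0)%C ->
  (forall j, # j + s5 <> 0)%C -> (forall j, # j + s6 <> 0)%C ->
  (hyp_term
    [v; (1 + w)%C; (1 + l1)%C; (1 + l2)%C; s3; s4; s5; s6]
    [w; l1; l2; (1 + s3)%C; (1 + s4)%C; (1 + s5)%C; (1 + s6)%C] (% (-1)) n : ℂ) =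
  (s3 * s4 * s5 * s6 / (4 * w * l1 * l2) *
    (cf v n * pole_pair s3 s5 n + cf v n * pole_pair s4 s6 n))%C.
Proof.
  intros Hw HS Hl1 Hl2 s3 s4 s5 s6 Nw Nl1 Nl2 N3 N4 N5 N6.
  assert (X0 : forall x : ℂ, (forall j, # j + x <> 0)%C -> x <> 0%C).
  { intros x Hx E. apply (Hx O). rewrite E. change (# 0) with (Complex.RtoC 0). ring. }
  assert (X1 : forall x : ℂ, (forall k, x <> (% (- INR k))) -> x <> 0%C).
  { intros x Hx E. apply (Hx O). rewrite E. apply Cpair_eq; simpl; change (INR 0) with 0; ring. }
  assert (X2 : forall x : ℂ, (forall j, # j + x <> 0)%C -> poch (1 + x)%C n <> (0 : ℂ)%C).
  { intros x Hx. apply poch_neq_0. apply notin_poles. intros j E. apply (Hx (Datatypes.S j)).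
    rewrite INR_C_S, <- E. ring. }
  assert (X3 : forall x : ℂ, x <> 0%C -> poch (1 + x)%C n = ((x + # n) / x * poch x n)%C).
  { intros x Hx. assert (P := poch_shift x n).
    assert (Q : (x * poch (1 + x)%C n / x)%C = poch (1 + x)%C n) by (field; auto).
    assert (R : ((x + # n) / x * poch x n)%C = (x * poch (1 + x)%C n / x)%C)
      by (rewrite P; unfold Complex.Cdiv; ring).
    now rewrite R, Q. }
  (* Opposite direction to [X3]: for the sigma_j it is (1 + x)_n that stands in the denominator and
     is nonzero by [X2]. *)
  assert (X4 : forall x : ℂ, (forall j, # j + x <> 0)%C ->
     poch x n = (x / (# n + x) * poch (1 + x)%C n)%C).
  { intros x Hx. assert (P := poch_shift x n). assert (Hn := Hx n).
    assert (Q : ((x + # n) * poch x n / (# n + x))%C = poch x n) by (field; auto).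
    assert (R : (x / (# n + x) * poch (1 + x)%C n)%C = ((x + # n) * poch x n / (# n + x))%C)
      by (rewrite <- P; unfold Complex.Cdiv; ring).
    now rewrite R, Q. }
  assert (Pw := poch_neq_0 w n Nw). assert (Pl1 := poch_neq_0 l1 n Nl1).
  assert (Pl2 := poch_neq_0 l2 n Nl2).
  assert (P3 := X2 _ N3). assert (P4 := X2 _ N4). assert (P5 := X2 _ N5). assert (P6 := X2 _ N6).
  assert (Z3 := X0 _ N3). assert (Z4 := X0 _ N4). assert (Z5 := X0 _ N5). assert (Z6 := X0 _ N6).
  assert (Yw := X1 _ Nw). assert (Yl1 := X1 _ Nl1). assert (Yl2 := X1 _ Nl2).
  assert (F := fact_C_neq_0 n).
  assert (C4 : Complex.RtoC 4 <> 0%C) by (intros E; apply (f_equal fst) in E; simpl in E; lra).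
  unfold hyp_term, prodC. cbn [map fold_right].
  rewrite (X3 w Yw), (X3 l1 Yl1), (X3 l2 Yl2), (X4 s3 N3), (X4 s4 N4), (X4 s5 N5), (X4 s6 N6).
  rewrite Cmul_Cmult, Cdiv_Cdiv, RtoC_RtoC. change CC1 with (Complex.RtoC 1).
  assert (CP : (Defs.Cpow (% (-1)) n * poch v n / # (fact n))%C = cf v n).
  { rewrite <- cf_poch. field. auto. }
  assert (T := term_partial_fractions (w + # n)%C A B).
  assert (E3 : (w + # n - A - B)%C = (# n + s3)%C) by (unfold s3; ring).
  assert (E4 : (w + # n - A + B)%C = (# n + s4)%C) by (unfold s4; ring).
  assert (E5 : (w + # n + A + B)%C = (# n + s5)%C) by (unfold s5; ring).
  assert (E6 : (w + # n + A - B)%C = (# n + s6)%C) by (unfold s6; ring).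
  rewrite E3, E4, E5, E6 in T. specialize (T (N3 n) (N4 n) (N5 n) (N6 n)).
  (* S^2 = A^2 + B^2 lets lambda_1 and lambda_2 factor the quadratic in the numerator of the partial
     fraction. *)
  assert (EL : ((w + # n) * (w + # n) - A * A - B * B)%C = ((l1 + # n) * (l2 + # n))%C).
  { rewrite Hl1, Hl2. transitivity ((w + # n) * (w + # n) - (A * A + B * B))%C; [ring|].
    rewrite <- HS. ring. }
  rewrite EL in T.
  assert (M3 := N3 n). assert (M4 := N4 n). assert (M5 := N5 n). assert (M6 := N6 n).
  transitivity (s3 * s4 * s5 * s6 / (w * l1 * l2) * cf v n *
    ((w + # n) * ((l1 + # n) * (l2 + # n)) / ((# n + s3) * (# n + s4) * (# n + s5) * (# n + s6))))%C.
  - rewrite <- CP. clearbody s3 s4 s5 s6.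
    set (p1 := poch w n) in *. set (p2 := poch l1 n) in *. set (p3 := poch l2 n) in *.
    set (p4 := poch (1 + s3)%C n) in *. set (p5 := poch (1 + s4)%C n) in *.
    set (p6 := poch (1 + s5)%C n) in *. set (p7 := poch (1 + s6)%C n) in *.
    match goal with |- ?L = ?R => change (@eq ℂ L R) end.
    field. repeat split; auto.
  - rewrite T. unfold pole_pair. field. repeat split; auto.
Qed.

Theorem mainTheorem7 (v a b c s : CC)
  (hv : Cre v < 2) (hc : Cre c > 0)
  (h1 : Cre (Cadd (Cadd (Cmul v c) a) b) > 0)
  (h2 : Cre (Csub (Cadd (Cmul v c) a) b) > 0)
  (h3 : Cre (Cadd (Csub (Cmul v c) a) b) > 0)
  (h4 : Cre (Csub (Csub (Cmul v c) a) b) > 0)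
  (hs : Cmul s s = Cadd (Cmul a a) (Cmul b b)) :
  let v2 := Cdiv v CC2 in
  let lam1 := Csub v2 (Cdiv s (Cmul CC2 c)) in
  let lam2 := Cadd v2 (Cdiv s (Cmul CC2 c)) in
  let A := Cdiv a (Cmul CC2 c) in
  let B := Cdiv b (Cmul CC2 c) in
  let sig3 := Csub (Csub v2 A) B in
  let sig4 := Cadd (Csub v2 A) B in
  let sig5 := Cadd (Cadd v2 A) B in
  let sig6 := Csub (Cadd v2 A) B in
  let vc := Cmul v c in
  let P := Cmul (Cmul (Cmul (Csub (Csub vc a) b) (Cadd (Cadd vc a) b))
                      (Cadd (Csub vc a) b)) (Csub (Cadd vc a) b) in
  let D := Csub (Csub (Cmul (Cpow v 3) (Cpow c 4)) (Cmul (Cmul (Cmul a a) v) (Cmul c c)))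
                (Cmul (Cmul (Cmul b b) v) (Cmul c c)) in
  notin_Z0m v2 -> notin_Z0m lam1 -> notin_Z0m lam2 ->
  notin_Z0m (Cadd CC1 sig3) -> notin_Z0m (Cadd CC1 sig4) ->
  notin_Z0m (Cadd CC1 sig5) -> notin_Z0m (Cadd CC1 sig6) ->
  hyper_sum
    [v; Cadd CC1 v2; Cadd CC1 lam1; Cadd CC1 lam2; sig3; sig4; sig5; sig6]
    [v2; lam1; lam2; Cadd CC1 sig3; Cadd CC1 sig4; Cadd CC1 sig5; Cadd CC1 sig6]
    (RtoC (-1))
    (Cmul (Cmul (Cdiv P (Cmul CC8 D)) (rGamma v))
          (Cadd (Cmul (CGamma sig5) (CGamma sig3)) (Cmul (CGamma sig6) (CGamma sig4)))).
Proof.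
  cbv zeta. unfold CGamma, CC2, CC8.
  change (Defs.Cpow v 3) with (Cmul v (Cmul v (Cmul v CC1))).
  change (Defs.Cpow c 4) with (Cmul c (Cmul c (Cmul c (Cmul c CC1)))).
  change CC1 with (Complex.RtoC 1).
  rewrite Cadd_Cplus, Csub_Cminus, Cmul_Cmult, Cinv_Cinv, Cdiv_Cdiv, RtoC_RtoC in *.
  intros Nw Nl1 Nl2 N3 N4 N5 N6.
  (* Positive real parts enter as c <> 0 and as nonvanishing of the four factors of P. *)
  apply CC_neq_0_of_fst in hc, h1, h2, h3, h4.
  assert (C2 : Complex.RtoC 2 <> 0%C) by (intros E; apply (f_equal fst) in E; simpl in E; lra).
  assert (C8 : Complex.RtoC 8 <> 0%C) by (intros E; apply (f_equal fst) in E; simpl in E; lra).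
  assert (C4 : Complex.RtoC 4 <> 0%C) by (intros E; apply (f_equal fst) in E; simpl in E; lra).
  set (A := (a / (2 * c))%C) in *. set (B := (b / (2 * c))%C) in *.
  set (S := (s / (2 * c))%C) in *. set (w := (v / 2)%C) in *.
  set (l1 := (w - S)%C) in *. set (l2 := (w + S)%C) in *.
  set (s3 := (w - A - B)%C) in *. set (s4 := (w - A + B)%C) in *.
  set (s5 := (w + A + B)%C) in *. set (s6 := (w + A - B)%C) in *.
  set (P := ((v * c - a - b) * (v * c + a + b) * (v * c - a + b) * (v * c + a - b))%C).
  set (D := (v * (v * (v * 1)) * (c * (c * (c * (c * 1)))) - a * a * v * (c * c) - b * b * v * (c * c))%C).
  (* For j = 0 the pole is excluded by y = x/(2c) with x <> 0, for larger j by the hypothesis on 1 +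
     y. *)
  assert (F : forall x y : ℂ, (x <> 0)%C -> notin_Z0m (1 + y)%C -> (y = x / (2 * c))%C ->
            (forall j, # j + y <> 0)%C).
  { intros x y Hx Hy E j Hj. destruct j as [|j].
    - apply Hx. change (# 0) with (Complex.RtoC 0) in Hj.
      replace x with ((0 + y) * (2 * c))%C by (rewrite E; field; auto). rewrite Hj. ring.
    - apply (Hy j). rewrite INR_C_S in Hj.
      assert (Z : (# j + 1 + y - # j)%C = (1 + y)%C) by ring.
      etransitivity; [symmetry; exact Z|]. rewrite Hj. apply Cpair_eq; simpl; ring. }
  assert (F3 := F _ s3 h4 N3 ltac:(unfold s3, w, A, B; field; auto)).
  assert (F4 := F _ s4 h3 N4 ltac:(unfold s4, w, A, B; field; auto)).
  assert (F5 := F _ s5 h1 N5 ltac:(unfold s5, w, A, B; field; auto)).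
  assert (F6 := F _ s6 h2 N6 ltac:(unfold s6, w, A, B; field; auto)).
  assert (Hw : (w + w = v)%C) by (unfold w; field; auto).
  assert (HS : (S * S = A * A + B * B)%C).
  { transitivity ((s * s) / (2 * c * (2 * c)))%C; [unfold S; field; auto|].
    rewrite hs. unfold A, B. field. auto. }
  assert (Hterm := fun n => hyp_term_partial_fractions v w l1 l2 A B S n Hw HS eq_refl eq_refl
    Nw Nl1 Nl2 F3 F4 F5 F6).
  cbv zeta in Hterm. fold s3 s4 s5 s6 in Hterm.
  assert (L1 := beta_sum v s3 s5 ltac:(rewrite <- Hw; unfold s3, s5; ring) hv F3 F5).
  assert (L2 := beta_sum v s4 s6 ltac:(rewrite <- Hw; unfold s4, s6; ring) hv F4 F6).
  set (k := (s3 * s4 * s5 * s6 / (4 * w * l1 * l2))%C) in *.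
  assert (L := Cseq_cv_mult _ _ _ _ (Cseq_cv_const k) (Cseq_cv_plus _ _ _ _ L1 L2)).
  unfold hyper_sum, Cseries_sum.
  match goal with |- Cseq_cv _ ?X => set (rhs := X) end.
  assert (Erhs : rhs = (k * (rGamma v * (/ rGamma s3 * / rGamma s5) +
    rGamma v * (/ rGamma s4 * / rGamma s6)))%C).
  (* P = 16 c^4 sigma_3 sigma_4 sigma_5 sigma_6 and D = 8 c^4 (v/2) lambda_1 lambda_2, which matches
     the factor 1/4 in [k]. *)
  { assert (Hk : (k = P / (8 * D))%C).
    { unfold P, D.
      assert (E1 : ((v * c - a - b) * (v * c + a + b) * (v * c - a + b) * (v * c + a - b) =
                   16 * (c * c * c * c) * (s3 * s4 * s5 * s6))%C).
      { assert (R3 : (v * c - a - b = 2 * c * s3)%C) by (unfold s3, w, A, B; field; auto).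
        assert (R4 : (v * c - a + b = 2 * c * s4)%C) by (unfold s4, w, A, B; field; auto).
        assert (R5 : (v * c + a + b = 2 * c * s5)%C) by (unfold s5, w, A, B; field; auto).
        assert (R6 : (v * c + a - b = 2 * c * s6)%C) by (unfold s6, w, A, B; field; auto).
        rewrite R3, R4, R5, R6. ring. }
      assert (E2 : (v * (v * (v * 1)) * (c * (c * (c * (c * 1)))) - a * a * v * (c * c) - b * b * v * (c * c) =
                   8 * (c * c * c * c) * (w * l1 * l2))%C).
      { transitivity (8 * (c * c * c * c) * (w * (w * w - S * S)))%C; [|unfold l1, l2; ring].
        rewrite HS. unfold w, A, B. field. auto. }
      rewrite E1, E2. unfold k.
      assert (Zw : w <> 0%C) by (intros E; apply (Nw O); etransitivity; [exact E|];
        apply Cpair_eq; simpl; change (INR 0) with 0; ring).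
      assert (Z1 : l1 <> 0%C) by (intros E; apply (Nl1 O); etransitivity; [exact E|];
        apply Cpair_eq; simpl; change (INR 0) with 0; ring).
      assert (Z2 : l2 <> 0%C) by (intros E; apply (Nl2 O); etransitivity; [exact E|];
        apply Cpair_eq; simpl; change (INR 0) with 0; ring).
      clearbody s3 s4 s5 s6 w l1 l2. field. auto 10. }
    unfold rhs. rewrite <- Hk. match goal with |- ?L = ?R => change (@eq ℂ L R) end. ring. }
  rewrite Erhs.
  refine (Cseq_cv_ext _ _ _ 0 _ L). intros n _.
  (* The partial sum up to index n has n + 1 terms, which matches the [S m] in [beta_sum]. *)
  rewrite Cpartial_csum, <- csum_plus, <- csum_scal. apply csum_ext. intros i _.
  symmetry. apply Hterm.
Qed.
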